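(* The system $\mathrm{RCA}_0^\omega+\mathrm{IND}+\mathrm{ADS}$ proves $\mathrm{SUB}_0\leftrightarrow\mathrm{QF\text{-}AC}^{0,1}$. Here $\mathrm{SUB}_0$ is the statement: for $D$ a directed subset of Baire space and $x_d:D\to[0,1]$ an increasing net converging to $x\in[0,1]$, there is $\Phi:\mathbb{N}\to D$ such that the sequence $\lambda n.x_{\Phi(n)}$ is increasing and $\lim_{n\to\infty}x_{\Phi(n)}=_{\mathbb{R}}x$.
   Context: Base theory. Finite types: $0$ (natural numbers) is a type, and if $\sigma,\tau$ are types then so is $\sigma\to\tau$ (mappings from type $\sigma$ to type $\tau$ objects); $1:=0\to0$ and $n+1:=n\to0$; a superscript on a variable is its type. $L_\omega$ is the language with variables and quantifiers of all finite types, constants $0,1,<_0,+_0,\times_0,=_0$ on $\mathbb{N}$, the combinators $\Pi,\Sigma$ and a recursor constant $\mathbf{R}_0$. Equality at higher types is defined extensionally: $x=_\tau y$ iff $xz_1\dots z_k=_0yz_1\dots z_k$ for all arguments. $\mathrm{QF\text{-}AC}^{\sigma,\tau}$ is the schema $(\forall x^\sigma)(\exists y^\tau)A(x,y)\to(\exists Y^{\sigma\to\tau})(\forall x^\sigma)A(x,Y(x))$ for quantifier-free $A$ of $L_\omega$ (parameters of any type allowed); $\mathrm{QF\text{-}AC}^{0,1}$ is the case $\sigma=0,\tau=1$. $\mathrm{RCA}_0^\omega$ is the theory in $L_\omega$ with classical logic and the axioms: $\mathbb{N}$ is an ordered semi-ring; the defining axioms of $\Pi,\Sigma$ (giving $\lambda$-abstraction);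 $\mathbf{R}_0(f,m,0)=m$ and $\mathbf{R}_0(f,m,n+1)=f(n,\mathbf{R}_0(f,m,n))$; extensionality $x=_\rho y\to\varphi(x)=_\tau\varphi(y)$ for all types $\rho,\tau$ and $\varphi^{\rho\to\tau}$; induction for quantifier-free formulas of $L_\omega$; $\mathrm{QF\text{-}AC}^{1,0}$. $\mathrm{IND}$ is the induction schema for all formulas of $L_\omega$. $\mathrm{ADS}$ is the second-order statement that every infinite linear order (on a subset of $\mathbb{N}$) has an infinite ascending or an infinite descending sequence. Reals. A real is a sequence of rationals $(q_n)$ with $|q_n-q_{n+i}|<2^{-n}$ for all $n,i$ (a type 1 object); $(q_n)=_{\mathbb{R}}(r_n)$ iff $|q_n-r_n|\le2^{-n+1}$ for all $n$. Sets. A subset $D$ of Baire space $\mathbb{N}^{\mathbb{N}}$ is given by a characteristic function $F_D^2\le1$ ($f\in D$ means $F_D(f)=1$); a binary relation $\preceq$ on $D$ is likewise given by a characteristic function of type $(1\times1)\to0$. Nets. $(D,\preceq)$ with $D\neq\emptyset$ is directed if $\preceq$ is transitive and reflexive on $D$ and for all $x,y\in D$ there is $z\in D$ with $x\preceq z$ and $y\preceq z$. A net in $X\subseteq\mathbb{R}$ is a map $x_d:D\to X$ with $(D,\preceq)$ directed; all index sets are subsets of Baire space given by characteristic functions $F_D^2\le1$, with $\preceq$ given by a characteristic function of type $(1\times1)\to0$. The net $x_d$ is increasing if $a\preceq b$ implies $x_a\le_{\mathbb{R}}x_b$ for all $a,b\in D$. It converges to $y$ if $(\forall\varepsilon>0)(\exists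 d_0\in D)(\forall e\succeq d_0)(|x_e-y|<\varepsilon)$. *)

(* Defs.v *)
(* Only the standard prelude and [List] are used: everything below is finitary
   syntax, namely a deep embedding of the many-sorted language L_omega, its
   natural deduction calculus, and the theories and sentences of interest. *)
From Stdlib Require Import List.
Import ListNotations.

Set Implicit Arguments.
Unset Strict Implicit.
Unset Printing Implicit Defensive.

Inductive ty : Type :=
| Nat : ty
| Arr : ty -> ty -> ty.

Declare Scope ty_scope.
Delimit Scope ty_scope with ty.
Bind Scope ty_scope with ty.
Notation "s ~> t" := (Arr s t) (at level 55, right associativity) : ty_scope.
Notation "0" := Nat : ty_scope.
Notation "1" := (Nat ~> Nat)%ty : ty_scope.
Notation "2" := ((Nat ~> Nat) ~> Nat)%ty : ty_scope.

(* Terms and formulas are intrinsically typed and well-scoped.  A context lists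
   the types of the free variables, the most recently bound one first;
   [mem G s] is the type of de Bruijn variables of type [s] in [G]. *)
Definition ctx := list ty.

Inductive mem : ctx -> ty -> Type :=
| here : forall G s, mem (s :: G) s
| there : forall G s t, mem G s -> mem (t :: G) s.
Arguments here {G s}.
Arguments there {G s t} v.

Inductive cst : ty -> Type :=
| Zero : cst 0
| One : cst 0
| Plus : cst (0 ~> 0 ~> 0)
| Times : cst (0 ~> 0 ~> 0)
| Pi : forall r t, cst (r ~> t ~> r)
| Sigma : forall d r t, cst ((d ~> r ~> t) ~> (d ~> r) ~> d ~> t)
| Rec0 : cst ((0 ~> 0 ~> 0) ~> 0 ~> 0 ~> 0).
Arguments Pi {r t}.
Arguments Sigma {d r t}.

Inductive tm (G : ctx) : ty -> Type :=
| Var : forall s, mem G s -> tm G s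
| Cst : forall s, cst s -> tm G s
| App : forall s t, tm G (s ~> t) -> tm G s -> tm G t.
Arguments Var {G s} v.
Arguments Cst {G s} c.

Inductive fm : ctx -> Type :=
| Eq : forall G, tm G 0 -> tm G 0 -> fm G
| Lt : forall G, tm G 0 -> tm G 0 -> fm G
| Bot : forall G, fm G
| Imp : forall G, fm G -> fm G -> fm G
| And : forall G, fm G -> fm G -> fm G
| Or : forall G, fm G -> fm G -> fm G
| All : forall G s, fm (s :: G) -> fm G
| Ex : forall G s, fm (s :: G) -> fm G.
Arguments Bot {G}.
Arguments All {G} s A.
Arguments Ex {G} s A.

Fixpoint qf {G} (A : fm G) : bool :=
  match A with
  | Eq _ _ | Lt _ _ | Bot => true
  | Imp A B | And A B | Or A B => andb (qf A) (qf B)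
  | All _ _ | Ex _ _ => false
  end.

Declare Scope tm_scope.
Delimit Scope tm_scope with tm.
Bind Scope tm_scope with tm.
Declare Scope fm_scope.
Delimit Scope fm_scope with fm.
Bind Scope fm_scope with fm.
Local Open Scope tm_scope.
Local Open Scope fm_scope.

Notation v0 := (Var here).
Notation v1 := (Var (there here)).
Notation v2 := (Var (there (there here))).
Notation v3 := (Var (there (there (there here)))).
Notation v4 := (Var (there (there (there (there here))))).

Notation "f $ a" := (App f a) (at level 29, left associativity) : tm_scope.
Notation "0" := (Cst Zero) : tm_scope.
Notation "1" := (Cst One) : tm_scope.
Notation "a + b" := (App (App (Cst Plus) a) b) : tm_scope.
Notation "a * b" := (App (App (Cst Times) a) b) : tm_scope.

Notation "a == b" := (Eq a b) (at level 70, no associativity) : fm_scope.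
Notation "a < b" := (Lt a b) : fm_scope.
Notation "A =>> B" := (Imp A B) (at level 90, right associativity) : fm_scope.
Notation "A /\ B" := (And A B) : fm_scope.
Notation "A \/ B" := (Or A B) : fm_scope.
Notation "~ A" := (Imp A Bot) : fm_scope.
Notation "a <= b" := (Or (Lt a b) (Eq a b)) : fm_scope.

(* Case analysis on a variable of [s :: G]; it extends environments,
   renamings and substitutions alike. *)
Definition scons {P : ty -> Type} {G s} (h : P s) (f : forall r, mem G r -> P r)
    : forall r, mem (s :: G) r -> P r :=
  fun r v =>
    match v in mem D r return
      match D return Type with
      | [] => unit
      | s' :: G' => P s' -> (forall r, mem G' r -> P r) -> P r
      end
    with
    | here => fun h _ => h
    | there w => fun _ f => f _ w
    end h f.

Definition ren (G D : ctx) := forall r, mem G r -> mem D r.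
Definition sub (G D : ctx) := forall r, mem G r -> tm D r.

Fixpoint subst_tm {G D} (th : sub G D) {s} (u : tm G s) : tm D s :=
  match u with
  | Var v => th _ v
  | Cst c => Cst c
  | App f a => App (subst_tm th f) (subst_tm th a)
  end.

Definition ren_sub {G D} (rho : ren G D) : sub G D := fun r v => Var (rho r v).

Definition wk {G t s} (u : tm G s) : tm (t :: G) s :=
  subst_tm (ren_sub (fun r v => there v)) u.

Notation wk2 u := (wk (wk u)).

Definition up {G D s} (th : sub G D) : sub (s :: G) (s :: D) :=
  scons (P := tm (s :: D)) v0 (fun r v => wk (th r v)).

Fixpoint subst {G} (A : fm G) : forall {D}, sub G D -> fm D :=
  match A with
  | Eq a b => fun D th => subst_tm th a == subst_tm th b
  | Lt a b => fun D th => subst_tm th a < subst_tm th b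
  | Bot => fun D th => Bot
  | Imp A B => fun D th => subst A th =>> subst B th
  | And A B => fun D th => subst A th /\ subst B th
  | Or A B => fun D th => subst A th \/ subst B th
  | All s A => fun D th => All s (subst A (up th))
  | Ex s A => fun D th => Ex s (subst A (up th))
  end.

Definition inst {G s} (A : fm (s :: G)) (u : tm G s) : fm G :=
  subst A (scons (P := tm G) u (fun r v => Var v)).

Definition wk_fm {G t} (A : fm G) : fm (t :: G) :=
  subst A (ren_sub (fun r v => there v)).

Definition no_var {G} : sub [] G :=
  fun r v =>
    match v in mem D r return match D with [] => tm G r | _ => unit end with
    | here => tt
    | there _ => tt
    end.

Definition lift {G} (A : fm []) : fm G := subst A no_var.

Fixpoint closure {G} : fm G -> fm [] :=
  match G return fm G -> fm [] with
  | [] => fun A => A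
  | s :: G' => fun A => closure (All s A)
  end.

(* [lam] is bracket abstraction by means of Pi and Sigma; [abs] carries the
   abstraction of each variable. *)
Fixpoint abs {D G s} (f : forall r, mem D r -> tm G (s ~> r)) {t} (u : tm D t)
    : tm G (s ~> t) :=
  match u with
  | Var v => f _ v
  | Cst c => Cst Pi $ Cst c
  | App g a => Cst Sigma $ abs f g $ abs f a
  end.

Definition lam {G s t} (u : tm (s :: G) t) : tm G (s ~> t) :=
  abs (scons (P := fun r => tm G (s ~> r))
         (Cst Sigma $ Cst Pi $ Cst (@Pi s s))
         (fun r v => Cst Pi $ Var v)) u.

Definition theory := fm [] -> Prop.

Inductive prv (T : theory) : forall G, list (fm G) -> fm G -> Prop :=
| P_hyp G (H : list (fm G)) A : In A H -> prv T H A
| P_ax G (H : list (fm G)) A : T A -> prv T H (lift A)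
| P_impI G (H : list (fm G)) A B : prv T (A :: H) B -> prv T H (A =>> B)
| P_impE G (H : list (fm G)) A B :
    prv T H (A =>> B) -> prv T H A -> prv T H B
| P_andI G (H : list (fm G)) A B :
    prv T H A -> prv T H B -> prv T H (A /\ B)
| P_andE1 G (H : list (fm G)) A B : prv T H (A /\ B) -> prv T H A
| P_andE2 G (H : list (fm G)) A B : prv T H (A /\ B) -> prv T H B
| P_orI1 G (H : list (fm G)) A B : prv T H A -> prv T H (A \/ B)
| P_orI2 G (H : list (fm G)) A B : prv T H B -> prv T H (A \/ B)
| P_orE G (H : list (fm G)) A B C :
    prv T H (A \/ B) -> prv T (A :: H) C -> prv T (B :: H) C -> prv T H C
| P_raa G (H : list (fm G)) A : prv T ((~ A) :: H) Bot -> prv T H A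
| P_allI G (H : list (fm G)) s (A : fm (s :: G)) :
    prv T (map wk_fm H) A -> prv T H (All s A)
| P_allE G (H : list (fm G)) s (A : fm (s :: G)) (u : tm G s) :
    prv T H (All s A) -> prv T H (inst A u)
| P_exI G (H : list (fm G)) s (A : fm (s :: G)) (u : tm G s) :
    prv T H (inst A u) -> prv T H (Ex s A)
| P_exE G (H : list (fm G)) s (A : fm (s :: G)) (B : fm G) :
    prv T H (Ex s A) -> prv T (A :: map wk_fm H) (wk_fm B) -> prv T H B
| P_refl G (H : list (fm G)) (a : tm G 0) : prv T H (a == a)
| P_leibniz G (H : list (fm G)) (A : fm (0%ty :: G)) (a b : tm G 0) :
    prv T H (a == b) -> prv T H (inst A a) -> prv T H (inst A b).

Definition proves (T : theory) (A : fm []) : Prop := prv T [] A.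

Definition union (T U : theory) : theory := fun A => (T A \/ U A)%type.
Definition axiom (A : fm []) : theory := fun B => B = A.

Declare Scope theory_scope.
Delimit Scope theory_scope with theory.
Bind Scope theory_scope with theory.
Notation "T + U" := (union T U) : theory_scope.

Fixpoint eqt {t} : forall {G}, tm G t -> tm G t -> fm G :=
  match t return forall G, tm G t -> tm G t -> fm G with
  | Nat => fun G a b => a == b
  | Arr s r => fun G f g => All s (eqt (wk f $ v0) (wk g $ v0))
  end.

Definition ordered_semiring : list (fm [0; 0; 0]%ty) :=
  let x := v0 in let y := v1 in let z := v2 in
  [ (x + y) + z == x + (y + z); x + y == y + x; x + 0 == x;
    (x * y) * z == x * (y * z); x * y == y * x; x * 1 == x; x * 0 == 0;
    x * (y + z) == x * y + x * z;
    ~ (x < x); x < y =>> y < z =>> x < z; x < y \/ x == y \/ y < x;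
    x < y =>> x + z < y + z; 0 < z =>> x < y =>> x * z < y * z;
    0 < 1 ].

Definition induction {G} (A : fm (0%ty :: G)) : fm G :=
  inst A 0
  =>> All 0 (A =>> subst A (scons (P := tm (0%ty :: G)) (v0 + 1)
                              (fun r v => Var (there v))))
  =>> All 0 A.

(* In [A] the variable [v0] is y, [v1] is x, and [G] holds the parameters;
   the substitution puts [Y x] for y in the context x, Y, G. *)
Definition choice {G s t} (A : fm (t :: s :: G)) : fm G :=
  All s (Ex t A)
  =>> Ex (s ~> t) (All s
        (subst A (scons (P := tm (s :: (s ~> t)%ty :: G)) (v1 $ v0)
                   (scons (P := tm (s :: (s ~> t)%ty :: G)) v0
                     (fun r v => Var (there (there v))))))).

Inductive QFAC (s t : ty) : theory :=
| QFAC_inst : forall G (A : fm (t :: s :: G)),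
    qf A = true -> QFAC s t (closure (choice A)).

Inductive IND : theory :=
| IND_inst : forall G (A : fm (0%ty :: G)), IND (closure (induction A)).

Inductive RCA0omega : theory :=
| RCA_semiring A : In A ordered_semiring -> RCA0omega (closure A)
| RCA_Pi r t :
    RCA0omega (All r (All t (eqt (Cst Pi $ v1 $ v0) v1)))
| RCA_Sigma d r t :
    RCA0omega (All (d ~> r ~> t) (All (d ~> r) (All d
      (eqt (Cst Sigma $ v2 $ v1 $ v0) (v2 $ v0 $ (v1 $ v0))))))
| RCA_Rec_0 :
    RCA0omega (All (0 ~> 0 ~> 0) (All 0 (Cst Rec0 $ v1 $ v0 $ 0 == v0)))
| RCA_Rec_S :
    RCA0omega (All (0 ~> 0 ~> 0) (All 0 (All 0
      (Cst Rec0 $ v2 $ v1 $ (v0 + 1) == v2 $ v0 $ (Cst Rec0 $ v2 $ v1 $ v0)))))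
| RCA_ext r t :
    RCA0omega (All (r ~> t) (All r (All r
      (eqt v1 v0 =>> eqt (v2 $ v1) (v2 $ v0)))))
| RCA_QF_IND G (A : fm (0%ty :: G)) :
    qf A = true -> RCA0omega (closure (induction A))
| RCA_QFAC A : QFAC 1 0 A -> RCA0omega A.

Section LinearOrders.
Context {G : ctx} (X : tm G 1) (R : tm G (0 ~> 0 ~> 0)).

Definition is_char_set : fm G := All 0 (wk X $ v0 <= 1).
Definition is_char_rel : fm G := All 0 (All 0 (wk2 R $ v1 $ v0 <= 1)).
Definition elt (a : tm G 0) : fm G := X $ a == 1.
Definition leqX (a b : tm G 0) : fm G := R $ a $ b == 1.
Definition ltX (a b : tm G 0) : fm G := leqX a b /\ ~ (a == b).
End LinearOrders.

Definition linear_order {G} (X : tm G 1) (R : tm G (0 ~> 0 ~> 0)) : fm G :=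
  All 0 (elt (wk X) v0 =>> leqX (wk R) v0 v0)
  /\ All 0 (All 0 (elt (wk2 X) v1 =>> elt (wk2 X) v0 =>>
       leqX (wk2 R) v1 v0 =>> leqX (wk2 R) v0 v1 =>> v1 == v0))
  /\ All 0 (All 0 (All 0
       (elt (wk (wk2 X)) v2 =>> elt (wk (wk2 X)) v1 =>> elt (wk (wk2 X)) v0 =>>
        leqX (wk (wk2 R)) v2 v1 =>> leqX (wk (wk2 R)) v1 v0 =>>
        leqX (wk (wk2 R)) v2 v0)))
  /\ All 0 (All 0 (elt (wk2 X) v1 =>> elt (wk2 X) v0 =>>
       leqX (wk2 R) v1 v0 \/ leqX (wk2 R) v0 v1)).

Definition infinite {G} (X : tm G 1) : fm G :=
  All 0 (Ex 0 (v1 < v0 /\ elt (wk2 X) v0)).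

Definition ascending {G} (X : tm G 1) (R : tm G (0 ~> 0 ~> 0)) (f : tm G 1)
    : fm G :=
  All 0 (elt (wk X) (wk f $ v0) /\ ltX (wk R) (wk f $ v0) (wk f $ (v0 + 1))).

Definition descending {G} (X : tm G 1) (R : tm G (0 ~> 0 ~> 0)) (f : tm G 1)
    : fm G :=
  All 0 (elt (wk X) (wk f $ v0) /\ ltX (wk R) (wk f $ (v0 + 1)) (wk f $ v0)).

(* Sets of numbers and binary relations on numbers, i.e. the second-order
   objects of ADS, are represented in L_omega by characteristic functions. *)
Definition ADS : fm [] :=
  All 1 (All (0 ~> 0 ~> 0)
    (let X := v1 in let R := v0 in
     is_char_set X =>> is_char_rel R =>> linear_order X R =>> infinite X =>>
     Ex 1 (ascending v2 v1 v0) \/ Ex 1 (descending v2 v1 v0))).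

(* Arithmetical functions are closed terms applied to their arguments.
   [fun1 b] is the function [v0 |-> b], and [fun2 b] the function
   [(v1, v0) |-> b]; [primrec b m n] iterates [b], in which [v1] is the counter
   and [v0] the previous value, [n] times from [m]. *)
Definition fun1 (b : tm [0]%ty 0) {G} (x : tm G 0) : tm G 0 :=
  subst_tm no_var (lam b) $ x.
Definition fun2 (b : tm [0; 0]%ty 0) {G} (x y : tm G 0) : tm G 0 :=
  subst_tm no_var (lam (lam b)) $ x $ y.
Definition primrec (b : tm [0; 0]%ty 0) {G} (m n : tm G 0) : tm G 0 :=
  Cst Rec0 $ subst_tm no_var (lam (lam b)) $ m $ n.

Definition predN {G} (n : tm G 0) : tm G 0 := primrec v1 0 n.
Definition monus {G} (m n : tm G 0) : tm G 0 := primrec (predN v0) m n.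
Definition is_zero {G} (n : tm G 0) : tm G 0 := primrec 0 1 n.
Definition pow2 {G} (n : tm G 0) : tm G 0 := primrec (v0 + v0) 1 n.
Definition triangle {G} (n : tm G 0) : tm G 0 := primrec (v0 + (v1 + 1)) 0 n.

(* Cantor's bijection [(a, b) |-> (a+b)(a+b+1)/2 + a] and its inverse;
   [diagonal z] is the largest [s] with [triangle s <= z]. *)
Definition pairN {G} : tm G 0 -> tm G 0 -> tm G 0 :=
  fun2 (let a := v1 in let b := v0 in triangle (a + b) + a).
Definition diagonal {G} (z : tm G 0) : tm G 0 :=
  primrec (v0 + is_zero (monus (triangle (v0 + 1)) (v1 + 1))) 0 z.
Definition fstN {G} : tm G 0 -> tm G 0 :=
  fun1 (let z := v0 in monus z (triangle (diagonal z))).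
Definition sndN {G} : tm G 0 -> tm G 0 :=
  fun1 (let z := v0 in monus (diagonal z) (fstN z)).

(* The number [rat p n d], i.e. the triple coded as (p, (n, d)), stands for the
   rational (p - n) / (d + 1); thus every number codes a rational, and distinct
   numbers may code the same one. *)
Definition rat {G} (p n d : tm G 0) : tm G 0 := pairN p (pairN n d).
Definition pos {G} (q : tm G 0) : tm G 0 := fstN q.
Definition neg {G} (q : tm G 0) : tm G 0 := fstN (sndN q).
Definition den {G} (q : tm G 0) : tm G 0 := sndN (sndN q) + 1.

Definition add_Q {G} : tm G 0 -> tm G 0 -> tm G 0 :=
  fun2 (let q := v1 in let r := v0 in
        rat (pos q * den r + pos r * den q) (neg q * den r + neg r * den q)
            (predN (den q * den r))).
Definition opp_Q {G} : tm G 0 -> tm G 0 :=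
  fun1 (let q := v0 in rat (neg q) (pos q) (predN (den q))).
Definition sub_Q {G} (q r : tm G 0) : tm G 0 := add_Q q (opp_Q r).
Definition abs_Q {G} : tm G 0 -> tm G 0 :=
  fun1 (let q := v0 in
        rat (monus (pos q) (neg q) + monus (neg q) (pos q)) 0 (predN (den q))).
Definition lt_Q {G} (q r : tm G 0) : fm G :=
  pos q * den r + neg r * den q < pos r * den q + neg q * den r.
Definition le_Q {G} (q r : tm G 0) : fm G :=
  pos q * den r + neg r * den q <= pos r * den q + neg q * den r.

(* 2^(-n) and 2^(-n+1) *)
Definition eps_Q {G} (n : tm G 0) : tm G 0 := rat 1 0 (predN (pow2 n)).
Definition eps2_Q {G} (n : tm G 0) : tm G 0 := rat (1 + 1) 0 (predN (pow2 n)).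

Definition is_real {G} (x : tm G 1) : fm G :=
  All 0 (All 0
    (lt_Q (abs_Q (sub_Q (wk2 x $ v1) (wk2 x $ (v1 + v0)))) (eps_Q v1))).

(* The one-sided version of [|q_n - r_n| <= 2^(-n+1)] for all [n]: the
   conjunction of [le_R x y] and [le_R y x] is the equality of reals. *)
Definition le_R {G} (x y : tm G 1) : fm G :=
  All 0 (le_Q (wk x $ v0) (add_Q (wk y $ v0) (eps2_Q v0))).
Definition lt_R {G} (x y : tm G 1) : fm G := ~ le_R y x.

Definition zero_R {G} : tm G 1 := lam (rat 0 0 0).
Definition one_R {G} : tm G 1 := lam (rat 1 0 0).

(* |x - y|; the shift of the index restores the rate of convergence. *)
Definition dist_R {G} (x y : tm G 1) : tm G 1 :=
  lam (abs_Q (sub_Q (wk x $ (v0 + 1)) (wk y $ (v0 + 1)))).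

Definition in_unit_interval {G} (x : tm G 1) : fm G :=
  is_real x /\ le_R zero_R x /\ le_R x one_R.

Definition AllPosReal {G} (A : fm (1%ty :: G)) : fm G :=
  All 1 (is_real v0 =>> lt_R zero_R v0 =>> A).

Definition is_char_set2 {G} (F : tm G 2) : fm G := All 1 (wk F $ v0 <= 1).
Definition is_char_rel2 {G} (L : tm G (1 ~> 1 ~> 0)) : fm G :=
  All 1 (All 1 (wk2 L $ v1 $ v0 <= 1)).

Definition elt2 {G} (F : tm G 2) (d : tm G 1) : fm G := F $ d == 1.
Definition rel2 {G} (L : tm G (1 ~> 1 ~> 0)) (d e : tm G 1) : fm G :=
  L $ d $ e == 1.

Definition AllIn {G} (F : tm G 2) (A : fm (1%ty :: G)) : fm G :=
  All 1 (elt2 (wk F) v0 =>> A).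
Definition ExIn {G} (F : tm G 2) (A : fm (1%ty :: G)) : fm G :=
  Ex 1 (elt2 (wk F) v0 /\ A).

Definition directed {G} (F : tm G 2) (L : tm G (1 ~> 1 ~> 0)) : fm G :=
  Ex 1 (elt2 (wk F) v0)
  /\ AllIn F (AllIn (wk F) (AllIn (wk2 F)
       (rel2 (wk (wk2 L)) v2 v1 =>> rel2 (wk (wk2 L)) v1 v0 =>>
        rel2 (wk (wk2 L)) v2 v0)))
  /\ AllIn F (rel2 (wk L) v0 v0)
  /\ AllIn F (AllIn (wk F) (ExIn (wk2 F)
       (rel2 (wk (wk2 L)) v2 v0 /\ rel2 (wk (wk2 L)) v1 v0))).

Definition net_in_unit_interval {G} (F : tm G 2) (X : tm G (1 ~> 1)) : fm G :=
  AllIn F (in_unit_interval (wk X $ v0)).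

Definition net_increasing {G} (F : tm G 2) (L : tm G (1 ~> 1 ~> 0))
    (X : tm G (1 ~> 1)) : fm G :=
  AllIn F (AllIn (wk F)
    (rel2 (wk2 L) v1 v0 =>> le_R (wk2 X $ v1) (wk2 X $ v0))).

Definition net_converges {G} (F : tm G 2) (L : tm G (1 ~> 1 ~> 0))
    (X : tm G (1 ~> 1)) (y : tm G 1) : fm G :=
  AllPosReal (ExIn (wk F) (AllIn (wk2 F)
    (rel2 (wk (wk2 L)) v1 v0 =>>
     lt_R (dist_R (wk (wk2 X) $ v0) (wk (wk2 y))) v2))).

Definition seq_increasing {G} (u : tm G (0 ~> 1)) : fm G :=
  All 0 (All 0 (v1 <= v0 =>> le_R (wk2 u $ v1) (wk2 u $ v0))).

Definition seq_converges {G} (u : tm G (0 ~> 1)) (y : tm G 1) : fm G :=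
  AllPosReal (Ex 0 (All 0
    (v1 <= v0 =>> lt_R (dist_R (wk (wk2 u) $ v0) (wk (wk2 y))) v2))).

Definition SUB0 : fm [] :=
  All 2 (All (1 ~> 1 ~> 0) (All (1 ~> 1) (All 1
    (let F := v3 in let L := v2 in let X := v1 in let x := v0 in
     is_char_set2 F =>> is_char_rel2 L =>> directed F L =>>
     net_in_unit_interval F X =>> net_increasing F L X =>>
     in_unit_interval x =>> net_converges F L X x =>>
     Ex (0 ~> 1)
       (let F := v4 in let X := v2 in let x := v1 in let Phi := v0 in
        let u := lam (wk X $ (wk Phi $ v0)) in
        All 0 (elt2 (wk F) (wk Phi $ v0))
        /\ seq_increasing u /\ seq_converges u x))))).

(* Main.v *)
(* The calculus is complete for extensional models of RCA_0^omega (Henkin's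
   construction, followed by identifying extensionally equal objects), so both
   directions may be argued inside an arbitrary model. Its numbers form an ordered
   semiring with induction, and its coded rationals lie in the ordered field of
   fractions of that semiring.

   SUB_0 -> QF-AC^{0,1}: suppose every n has an f with A(n, f). The finite sequences
   (f_0, ..., f_{k-1}) with A(i, f_i) for all i < k, each coded by a single function,
   are directed by comparing lengths, and exist in every length k by IND. The net
   k / (k + 1) is increasing and converges to 1, so a subsequence converging to 1 runs
   through sequences of unbounded length; QF-AC^{1,0} selects one longer than n, whose
   entry n is the required f.

   QF-AC^{0,1} -> SUB_0: an increasing net lies below its limit x. If x_d = x for some
   d, take a constant sequence. Otherwise choose d_k with x_{d_k} > x - 2^-k, then g(k)
   with x_{d_k} < x - 2^-g(k). With h(0) = 0 and h(n+1) = g(h(n)), the sequence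
   x_{d_{h(n)}} increases to x. *)
Require Import Defs.
From Stdlib Require Import List Lia Ring Eqdep_dec RelationClasses.
From Stdlib Require Import ClassicalEpsilon FunctionalExtensionality PropExtensionality.
From HB Require Import structures.
From mathcomp Require boolp all_boot all_order all_algebra ring lra.
Import ListNotations.

Set Implicit Arguments.
Unset Strict Implicit.
Unset Printing Implicit Defensive.
Unset Asymmetric Patterns.

(** The model may be nonstandard, and this shapes most constructions: finite sequences, iterations
    and inductions have to be internal. Every induction on numbers of the model exhibits a formula
    of the language, every recursion goes through [Rec0], and the field of fractions is Archimedean
    only with respect to the numbers of the model. Towards [SUB0] there are two obstacles. [Rec0]
    recurses on numbers alone, so net indices cannot be chosen one after the other: all [d_k] are
    chosen at once, and the recursion runs over the numbers [k]. Choice needs a quantifier-free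
    matrix, whereas strict inequality of reals is existential, so each chosen function also carries
    the index at which the inequality becomes visible. Towards choice, the set of finite sequences
    needs a characteristic function. [QFAC 1 0] decides the matrix, and a product computed by [Rec0]
    replaces the bounded quantifier. Two reductions keep the argument elementary: in the collapsed
    model equality is Rocq equality, so terms are evaluated by rewriting, and in the field
    inequalities between rationals are left to [lra]. *)

Section Quotient.
Variables (X : Type) (R : X -> X -> Prop).

(** Related elements have extensionally equal classes, so [epsilon] receives equal arguments and
    picks one representative per class; the quotient is then a plain subtype. *)
Definition canon (a : X) : X := epsilon (inhabits a) (R a).
Definition quot := {a : X | canon a = a}.

Lemma quot_eq (p q : quot) : proj1_sig p = proj1_sig q -> p = q.
Proof. destruct p, q; simpl. intros <-. f_equal. apply proof_irrelevance. Qed.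

Hypothesis eqv : Equivalence R.

Lemma canon_spec a : R a (canon a).
Proof. apply (epsilon_spec (inhabits a) (R a)). exists a. reflexivity. Qed.

Lemma canon_eq a b : R a b -> canon a = canon b.
Proof.
  intro h. unfold canon. rewrite (proof_irrelevance _ (inhabits a) (inhabits b)).
  f_equal. apply functional_extensionality; intro c. apply propositional_extensionality.
  split; intro k; [rewrite <- h|rewrite h]; exact k.
Qed.

Definition cls (a : X) : quot := exist _ (canon a) (eq_sym (canon_eq (canon_spec a))).

Lemma cls_eq a b : cls a = cls b <-> R a b.
Proof.
  split; intro h.
  - apply (f_equal (@proj1_sig _ _)) in h. simpl in h.
    rewrite (canon_spec a), h. symmetry. apply canon_spec.
  - apply quot_eq, canon_eq, h.
Qed.

Lemma cls_surj (p : quot) : p = cls (proj1_sig p).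
Proof. apply quot_eq. simpl. symmetry. apply (proj2_sig p). Qed.
End Quotient.

(** * Substitution *)

Lemma mem_case s G (P : forall r, mem (s :: G) r -> Prop) :
  P s here -> (forall r (v : mem G r), P r (there v)) -> forall r v, P r v.
Proof.
  intros h f r v.
  refine (match v as v' in mem D r' return
    match D return mem D r' -> Prop with
    | [] => fun _ => True
    | s' :: G' => fun v' => forall (P : forall r, mem (s' :: G') r -> Prop),
        P s' here -> (forall r (v : mem G' r), P r (there v)) -> P r' v'
    end v' with here => _ | there w => _ end P h f); auto.
Qed.

(** Substitutions, renamings and environments are all families of this kind, so each identity
    between them splits into the newest variable and the older ones. *)
Lemma fam_ext s G (Q : ty -> Type) (f g : forall r, mem (s :: G) r -> Q r) :
  f s here = g s here -> (forall r (v : mem G r), f r (there v) = g r (there v)) ->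
  f = g.
Proof.
  intros h k. apply functional_extensionality_dep; intro r.
  apply functional_extensionality; intro v. revert r v. now apply mem_case.
Qed.

Lemma fam_nil (Q : ty -> Type) (f g : forall r, mem [] r -> Q r) : f = g.
Proof.
  apply functional_extensionality_dep; intro r.
  apply functional_extensionality; intro v. inversion v.
Qed.

Lemma subst_tm_comp G D K (th : sub D K) (sg : sub G D) s (u : tm G s) :
  subst_tm th (subst_tm sg u) = subst_tm (fun r v => subst_tm th (sg r v)) u.
Proof. induction u; simpl; congruence. Qed.

Lemma subst_tm_var G s (u : tm G s) : subst_tm (fun r v => Var v) u = u.
Proof. induction u; simpl; congruence. Qed.

Lemma subst_tm_up_wk G D s t (th : sub G D) (u : tm G t) :
  subst_tm (up (s := s) th) (wk u) = wk (subst_tm th u).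
Proof. unfold wk. now rewrite !subst_tm_comp. Qed.

Lemma subst_tm_scons_wk G D s t (a : tm D s) (th : sub G D) (u : tm G t) :
  subst_tm (scons (P := tm D) a th) (wk u) = subst_tm th u.
Proof. unfold wk. now rewrite subst_tm_comp. Qed.

Lemma up_comp G D K s (th : sub D K) (sg : sub G D) :
  (fun r v => subst_tm (up (s := s) th) (up sg v))
  = up (fun r v => subst_tm th (sg r v)).
Proof. apply fam_ext; [reflexivity|]. intros r v. apply subst_tm_up_wk. Qed.

Lemma up_var G s : up (s := s) (fun r (v : mem G r) => Var v) = fun r v => Var v.
Proof. now apply fam_ext. Qed.

(** Terms have no binders, so composition on terms is settled outright and weakening is just one
    more substitution; on formulas only the passage under [up] remains. *)
Lemma subst_comp G (A : fm G) D K (sg : sub G D) (th : sub D K) :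
  subst (subst A sg) th = subst A (fun r v => subst_tm th (sg r v)).
Proof.
  revert D K sg th; induction A; intros; simpl;
    rewrite ?subst_tm_comp, ?IHA, ?IHA1, ?IHA2, ?up_comp; reflexivity.
Qed.

Lemma subst_var G (A : fm G) : subst A (fun r v => Var v) = A.
Proof.
  induction A; simpl; rewrite ?subst_tm_var, ?up_var; congruence.
Qed.

Lemma subst_inst G D s (A : fm (s :: G)) (u : tm G s) (th : sub G D) :
  subst (inst A u) th = inst (subst A (up th)) (subst_tm th u).
Proof.
  unfold inst. rewrite !subst_comp. f_equal. apply fam_ext; [reflexivity|].
  intros r v. simpl. rewrite subst_tm_scons_wk. now rewrite subst_tm_var.
Qed.

Lemma subst_up_wk_fm G D s (A : fm G) (th : sub G D) :
  subst (wk_fm A) (up (s := s) th) = wk_fm (subst A th).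
Proof. unfold wk_fm. now rewrite !subst_comp. Qed.

Lemma inst_wk_fm G s (A : fm G) (u : tm G s) : inst (wk_fm A) u = A.
Proof. unfold inst, wk_fm. rewrite subst_comp. apply subst_var. Qed.

Lemma subst_lift G D (A : fm []) (th : sub G D) : subst (lift A) th = lift A.
Proof. unfold lift. rewrite subst_comp. f_equal. apply fam_nil. Qed.

Lemma inst_up G D s (A : fm (s :: G)) (u : tm D s) (th : sub G D) :
  inst (subst A (up th)) u = subst A (scons (P := tm D) u th).
Proof.
  unfold inst. rewrite subst_comp. f_equal. apply fam_ext; [reflexivity|].
  intros r v. simpl. rewrite subst_tm_scons_wk. apply subst_tm_var.
Qed.

Lemma qf_subst G (A : fm G) D (th : sub G D) : qf (subst A th) = qf A.
Proof. revert D th; induction A; intros; simpl; rewrite ?IHA1, ?IHA2; auto. Qed.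

(** * Structural rules of the calculus *)

Lemma prv_incl T G (H : list (fm G)) A :
  prv T H A -> forall H', incl H H' -> prv T H' A.
Proof.
  assert (C : forall G (a : fm G) H H', incl H H' -> incl (a :: H) (a :: H'))
    by (intros; intros x [|]; simpl; auto).
  induction 1; intros H' I.
  all: try solve [econstructor; eauto using incl_map].
Qed.

Lemma prv_subst T G (H : list (fm G)) A :
  prv T H A -> forall D (th : sub G D),
  prv T (map (fun B => subst B th) H) (subst A th).
Proof.
  assert (C : forall G D s (H : list (fm G)) (th : sub G D),
    map (fun B => subst B (up (s := s) th)) (map wk_fm H)
    = map wk_fm (map (fun B => subst B th) H)).
  { intros. rewrite !map_map. apply map_ext. intro. apply subst_up_wk_fm. }
  induction 1; intros D th; simpl in *.
  all: try solve [econstructor; eauto].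
  - apply P_hyp. now apply (in_map (fun B => subst B th)).
  - rewrite subst_lift. now apply P_ax.
  - apply P_allI. rewrite <- C. apply IHprv.
  - rewrite subst_inst. apply P_allE. apply IHprv.
  - apply P_exI with (subst_tm th u). rewrite <- subst_inst. apply IHprv.
  - eapply P_exE; [apply IHprv1|]. rewrite <- C, <- subst_up_wk_fm. apply IHprv2.
  - rewrite subst_inst. eapply P_leibniz; [apply IHprv1|].
    rewrite <- subst_inst. apply IHprv2.
Qed.

Lemma prv_wk T G s (H : list (fm G)) A :
  prv T H A -> prv T (map (@wk_fm G s) H) (wk_fm A).
Proof. intro p. apply (prv_subst p). Qed.

Fixpoint default {G} (s : ty) : tm G s :=
  match s with
  | Nat => Cst Zero
  | Arr s t => App (Cst (@Pi t s)) (default t)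
  end.

(** Generalise over the fresh variable and instantiate it by a closed term. Since every type has
    one, the Henkin construction can add a dummy variable at any step without losing consistency. *)
Lemma prv_strengthen T G s (H : list (fm G)) A :
  prv T (map (@wk_fm G s) H) (wk_fm A) -> prv T H A.
Proof.
  intro p. rewrite <- (inst_wk_fm A (default s)). apply P_allE, P_allI, p.
Qed.

Lemma prv_cut T G (H : list (fm G)) A B : prv T H A -> prv T (A :: H) B -> prv T H B.
Proof. intros p q. eapply P_impE; [apply P_impI, q|exact p]. Qed.

Lemma prv_bot T G (H : list (fm G)) A : prv T H Bot -> prv T H A.
Proof. intro p. apply P_raa. apply (prv_incl p). intros x; simpl; auto. Qed.

(** Two uses of [P_raa]: in the absence of a counterexample, [A] is proved for a fresh variable,
    because that variable would itself be one. *)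
Lemma prv_not_all T G (H : list (fm G)) s (A : fm (s :: G)) :
  prv T H (~ All s A)%fm -> prv T H (Ex s (~ A)%fm).
Proof.
  intro p. apply P_raa. eapply P_impE.
  { apply (prv_incl p). intros x; simpl; auto. }
  apply P_allI. apply P_raa. simpl. eapply P_impE.
  { apply P_hyp. right. left. reflexivity. }
  simpl. apply P_exI with (Var here). unfold inst. simpl. rewrite !subst_comp.
  apply P_hyp. left. f_equal. rewrite <- (subst_var A) at 1. f_equal.
  now apply fam_ext.
Qed.

(** * Enumeration of formulas *)

(** Kept transparent so that the test at type [Nat] computes in [tms0_spec]. *)
Lemma ty_eq_dec (s t : ty) : {s = t} + {s <> t}.
Proof. decide equality. Defined.

Lemma in_flat_map_intro {X Y} (f : X -> list Y) l x y :
  In x l -> In y (f x) -> In y (flat_map f l).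
Proof. intros. apply in_flat_map. eauto. Qed.

Fixpoint tys (n : nat) : list ty :=
  match n with
  | O => []
  | S n => Nat :: flat_map (fun s => map (Arr s) (tys n)) (tys n)
  end.

Lemma tys_spec s : exists n, forall m, n <= m -> In s (tys m).
Proof.
  induction s as [|s [n Hn] t [k Hk]].
  - exists 1. intros [|m] I; [lia|]. now left.
  - exists (S (n + k)). intros [|m] I; [lia|]. right.
    apply in_flat_map_intro with s; [apply Hn; lia|]. apply in_map, Hk; lia.
Qed.

Fixpoint mems (G : ctx) : list {s & mem G s} :=
  match G with
  | [] => []
  | s :: G => existT _ s here :: map (fun p => existT _ _ (there (projT2 p))) (mems G)
  end.

Lemma mems_spec G s (v : mem G s) : In (existT _ s v) (mems G).
Proof.
  induction v; simpl; auto. right.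
  apply (in_map (fun p => existT (mem (t :: G)) _ (there (projT2 p))) _ _ IHv).
Qed.

Definition csts (n : nat) : list {s & cst s} :=
  [existT _ _ Zero; existT _ _ One; existT _ _ Plus; existT _ _ Times; existT _ _ Rec0]
  ++ flat_map (fun r => flat_map (fun t =>
       existT _ _ (@Pi r t) :: map (fun d => existT _ _ (@Sigma d r t)) (tys n))
       (tys n)) (tys n).

Lemma csts_spec s (c : cst s) : exists n, forall m, n <= m -> In (existT _ s c) (csts m).
Proof.
  unfold csts. destruct c; try (exists 0; intros; simpl; tauto).
  - destruct (tys_spec r) as [n Hn], (tys_spec t) as [k Hk]. exists (n + k). intros m I.
    apply in_or_app. right. apply in_flat_map_intro with r; [apply Hn; lia|].
    apply in_flat_map_intro with t; [apply Hk; lia|]. now left.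
  - destruct (tys_spec r) as [n Hn], (tys_spec t) as [k Hk], (tys_spec d) as [j Hj].
    exists (n + k + j). intros m I.
    apply in_or_app. right. apply in_flat_map_intro with r; [apply Hn; lia|].
    apply in_flat_map_intro with t; [apply Hk; lia|]. right.
    apply (in_map (fun d => existT cst _ (@Sigma d r t))). apply Hj; lia.
Qed.

Definition cast {P : ty -> Type} {s t} (e : s = t) (a : P s) : P t := eq_rect s P a t e.

Lemma cast_id (P : ty -> Type) s (e : s = s) (a : P s) : cast e a = a.
Proof. rewrite (UIP_dec ty_eq_dec e eq_refl). reflexivity. Qed.

Definition mk_app {G} (p q : {s & tm G s}) : list {s & tm G s} :=
  let (r, f) := p in
  match r return tm G r -> list {s & tm G s} with
  | Nat => fun _ => []
  | Arr s t => fun f =>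
      match ty_eq_dec (projT1 q) s with
      | left e => [existT _ t (App f (cast e (projT2 q)))]
      | right _ => []
      end
  end f.

Fixpoint tms (n : nat) (G : ctx) : list {s & tm G s} :=
  match n with
  | O => []
  | S n => map (fun p => existT _ _ (Var (projT2 p))) (mems G)
      ++ map (fun p => existT _ _ (Cst (projT2 p))) (csts n)
      ++ flat_map (fun p => flat_map (mk_app p) (tms n G)) (tms n G)
  end.

(* The bound is uniform in the renaming, so it survives the growth of the context. *)
Lemma tms_spec G s (u : tm G s) : exists n, forall m, n <= m -> forall D (rho : ren G D),
  In (existT _ s (subst_tm (ren_sub rho) u)) (tms m D).
Proof.
  induction u as [s v|s c|s t f [n Hn] a [k Hk]].
  - exists 1. intros [|m] I D rho; [lia|]. cbn [tms]. apply in_or_app. left.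
    apply (in_map (fun p => existT (tm D) _ (Var (projT2 p))) _ _ (mems_spec (rho s v))).
  - destruct (csts_spec c) as [n Hn]. exists (S n). intros [|m] I D rho; [lia|]. cbn [tms].
    apply in_or_app. right. apply in_or_app. left.
    apply (in_map (fun p => existT (tm D) _ (Cst (projT2 p))) _ (existT _ s c)).
    apply Hn; lia.
  - exists (S (n + k)). intros [|m] I D rho; [lia|]. cbn [tms].
    apply in_or_app. right. apply in_or_app. right.
    eapply in_flat_map_intro; [apply Hn; lia|].
    eapply in_flat_map_intro; [apply Hk; lia|].
    cbn [mk_app projT1]. destruct (ty_eq_dec s s) as [e|]; [|congruence]. left. now rewrite cast_id.
Qed.

Definition tms0 n G : list (tm G 0) :=
  flat_map (fun p => match ty_eq_dec (projT1 p) Nat with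
    | left e => [cast e (projT2 p)] | right _ => [] end) (tms n G).

Lemma tms0_spec G (u : tm G 0) : exists n, forall m, n <= m -> forall D (rho : ren G D),
  In (subst_tm (ren_sub rho) u) (tms0 m D).
Proof.
  destruct (tms_spec u) as [n Hn]. exists n. intros m I D rho.
  eapply in_flat_map_intro; [apply (Hn m I D rho)|]. simpl.
  left. reflexivity.
Qed.

Definition pairs {X Y} (f : X -> X -> Y) (l : list X) : list Y :=
  flat_map (fun a => map (f a) l) l.

Lemma in_pairs {X Y} (f : X -> X -> Y) l a b : In a l -> In b l -> In (f a b) (pairs f l).
Proof. intros. apply in_flat_map_intro with a; auto. now apply in_map. Qed.

(** Contexts grow during the construction, so instead of one fixed numbering of formulas there is a
    finite list for each level and each context. *)
Fixpoint fms (n : nat) (G : ctx) : list (fm G) :=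
  match n with
  | O => []
  | S n => Bot :: pairs (@Eq G) (tms0 n G) ++ pairs (@Lt G) (tms0 n G)
      ++ pairs (@Imp G) (fms n G) ++ pairs (@And G) (fms n G) ++ pairs (@Or G) (fms n G)
      ++ flat_map (fun s => map (All s) (fms n (s :: G))) (tys n)
      ++ flat_map (fun s => map (Ex s) (fms n (s :: G))) (tys n)
  end.

Lemma up_ren G D s (rho : ren G D) :
  exists rho' : ren (s :: G) (s :: D), up (ren_sub rho) = ren_sub rho'.
Proof.
  exists (scons (P := mem (s :: D)) here (fun r v => there (rho r v))).
  now apply fam_ext.
Qed.

Lemma fms_spec G (A : fm G) : exists n, forall m, n <= m -> forall D (rho : ren G D),
  In (subst A (ren_sub rho)) (fms m D).
Proof.
  induction A as [G a b|G a b|G|G A [n Hn] B [k Hk]|G A [n Hn] B [k Hk]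
                 |G A [n Hn] B [k Hk]|G s A [n Hn]|G s A [n Hn]].
  1, 2: destruct (tms0_spec a) as [n Hn], (tms0_spec b) as [k Hk].
  7, 8: destruct (tys_spec s) as [k Hk].
  3: { exists 1. intros [|m] I D rho; [lia|]. now left. }
  all: exists (S (n + k)); intros [|m] I D rho; [lia|]; simpl; right;
    rewrite !in_app_iff.
  - left. apply in_pairs; [apply Hn; lia|apply Hk; lia].
  - right; left. apply in_pairs; [apply Hn; lia|apply Hk; lia].
  - do 2 right; left. apply in_pairs; [apply Hn; lia|apply Hk; lia].
  - do 3 right; left. apply in_pairs; [apply Hn; lia|apply Hk; lia].
  - do 4 right; left. apply in_pairs; [apply Hn; lia|apply Hk; lia].
  - do 5 right; left. destruct (up_ren s rho) as [rho' ->].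
    apply in_flat_map_intro with s; [apply Hk; lia|]. apply in_map, Hn; lia.
  - do 6 right. destruct (up_ren s rho) as [rho' ->].
    apply in_flat_map_intro with s; [apply Hk; lia|]. apply in_map, Hn; lia.
Qed.

(** * Structures *)

Record structure := {
  dom : ty -> Type;
  app : forall s t, dom (Arr s t) -> dom s -> dom t;
  con : forall s, cst s -> dom s;
  less : dom Nat -> dom Nat -> Prop
}.
Arguments app {s0 s t} f a : rename.

Notation env M G := (forall r, mem G r -> dom M r).
Definition env_nil {M} : env M [] := fun r v =>
  match v in mem D r return match D with [] => dom M r | _ => unit end with
  | here => tt | there _ => tt end.
Notation "a :> rho" := (scons (P := dom _) a rho) (at level 60, right associativity).

Section Semantics.
Variables (M : structure) (E : dom M Nat -> dom M Nat -> Prop).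

Fixpoint eval {G} (rho : env M G) {s} (u : tm G s) : dom M s :=
  match u with
  | Var v => rho _ v
  | Cst c => con M c
  | App f a => app (eval rho f) (eval rho a)
  end.

(** Equality of numbers is the parameter [E]: the Henkin structure interprets it by provable
    equality, and only the quotient of that structure by equality proper. *)
Fixpoint sat {G} (A : fm G) : env M G -> Prop :=
  match A with
  | Eq a b => fun rho => E (eval rho a) (eval rho b)
  | Lt a b => fun rho => less (eval rho a) (eval rho b)
  | Bot => fun rho => False
  | Imp A B => fun rho => sat A rho -> sat B rho
  | And A B => fun rho => sat A rho /\ sat B rho
  | Or A B => fun rho => sat A rho \/ sat B rho
  | All s A => fun rho => forall a : dom M s, sat A (a :> rho)
  | Ex s A => fun rho => exists a : dom M s, sat A (a :> rho)
  end.
End Semantics.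
Arguments eval M {G} rho {s} u.
Arguments sat M E {G} A rho.

Lemma eval_subst M G D (th : sub G D) (rho : env M D) s (u : tm G s) :
  eval M rho (subst_tm th u) = eval M (fun r v => eval M rho (th r v)) u.
Proof. induction u; simpl; congruence. Qed.

Lemma eval_wk M G (rho : env M G) s t (a : dom M t) (u : tm G s) :
  eval M (a :> rho) (wk u) = eval M rho u.
Proof. unfold wk. now rewrite eval_subst. Qed.

Lemma sat_subst M E G (A : fm G) D (th : sub G D) (rho : env M D) :
  sat M E (subst A th) rho <-> sat M E A (fun r v => eval M rho (th r v)).
Proof.
  revert D th rho; induction A; intros D th rho; simpl;
    rewrite ?eval_subst, ?IHA1, ?IHA2; try tauto.
  all: assert (C : forall a : dom M s,
    (fun r v => eval M (a :> rho) (up th v)) = a :> (fun r v => eval M rho (th r v)))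
    by (intro a; apply fam_ext; [reflexivity|]; intros r v; apply eval_wk).
  - split; intros h a; specialize (h a); [rewrite IHA, C in h|rewrite IHA, C]; exact h.
  - split; intros [a h]; exists a; [rewrite IHA, C in h|rewrite IHA, C]; exact h.
Qed.

Lemma sat_inst M E G s (A : fm (s :: G)) (u : tm G s) (rho : env M G) :
  sat M E (inst A u) rho <-> sat M E A (eval M rho u :> rho).
Proof.
  unfold inst. rewrite sat_subst.
  replace (fun r v => _) with (eval M rho u :> rho) by now apply fam_ext.
  reflexivity.
Qed.

Lemma sat_closure M E G (A : fm G) :
  sat M E (closure A) env_nil <-> forall rho : env M G, sat M E A rho.
Proof.
  revert A; induction G as [|s G IH]; intro A; cbn [closure].
  - split; intros h; [|apply h]. intro rho. now rewrite (fam_nil rho env_nil).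
  - rewrite IH. split; intros h rho; [|intro a; apply h].
    specialize (h (fun r v => rho r (there v)) (rho s here)).
    replace rho with (rho s here :> (fun r v => rho r (there v))); auto.
    now apply fam_ext.
Qed.

(** * Henkin construction *)

(** [stodo] is the queue of formulas still to be decided; once empty it is refilled with all
    formulas of level [slevel] in the current context. *)
Record state := State {
  sctx : ctx;
  shyp : list (fm sctx);
  stodo : list (fm sctx);
  slevel : nat
}.

Definition witness {G} (A : fm G) : {s & list (fm (s :: G))} :=
  match A in fm G return {s & list (fm (s :: G))} with
  | @Ex G s B => existT (fun s => list (fm (s :: G))) s [B]
  | _ => existT _ Nat []
  end.

Section Henkin.
Variables (T : theory) (A0 : fm []).

Definition extension (S : state) : {s & list (fm (s :: sctx S))} :=
  match stodo S with
  | [] => existT _ Nat (map wk_fm (shyp S))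
  | A :: _ =>
      if excluded_middle_informative (prv T (A :: shyp S) Bot)
      then existT _ Nat (map wk_fm ((~ A)%fm :: shyp S))
      else existT _ _ (projT2 (witness A) ++ map wk_fm (A :: shyp S))
  end.

(* The context grows by exactly one variable per step, a dummy one of type 0 if
   no witness is due. *)
Definition next (S : state) : state :=
  {| sctx := projT1 (extension S) :: sctx S;
     shyp := projT2 (extension S);
     stodo := map wk_fm (match stodo S with [] => fms (slevel S) _ | _ :: l => l end);
     slevel := match stodo S with [] => Datatypes.S (slevel S) | _ :: _ => slevel S end |}.

Fixpoint stage (n : nat) : state :=
  match n with
  | O => {| sctx := []; shyp := [(~ A0)%fm]; stodo := []; slevel := 0 |}
  | S n => next (stage n)
  end.

Definition consistent (S : state) := ~ prv T (shyp S) Bot.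

(** A dummy variable is removed by [prv_strengthen], and a witness variable is an eigenvariable for
    [P_exE]. A rejected [A] was refutable; if its negation were inconsistent as well, [P_raa] would
    prove [A] and the old hypotheses would already be contradictory. *)
Lemma next_consistent S : consistent S -> consistent (next S).
Proof.
  destruct S as [G H [|A l] n]; unfold consistent, next, extension; simpl; intros C p.
  - apply C. now apply prv_strengthen with Nat.
  - destruct excluded_middle_informative as [q|q]; simpl in p.
    + apply C. apply prv_cut with A; [|exact q]. apply P_raa.
      now apply prv_strengthen with Nat.
    + apply q. destruct A; simpl in p;
        try (apply prv_strengthen with Nat; exact p).
      eapply P_exE; [apply P_hyp; left; reflexivity|exact p].
Qed.

Lemma next_incl S : incl (map wk_fm (shyp S)) (shyp (next S)).
Proof.
  destruct S as [G H [|B l] n]; unfold incl, next, extension; simpl; auto.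
  destruct excluded_middle_informative; simpl; auto.
  intros A h. apply in_or_app. right. now right.
Qed.

Lemma next_decides S A l : stodo S = A :: l ->
  prv T (shyp (next S)) (wk_fm A) \/ prv T (shyp (next S)) (wk_fm (~ A)%fm).
Proof.
  destruct S as [G H todo n]; simpl in *. intros ->. unfold next, extension; simpl.
  destruct excluded_middle_informative; simpl; [right|left]; apply P_hyp; simpl; auto.
  apply in_or_app. right. now left.
Qed.

Lemma next_witness S s B l : stodo S = Ex s B :: l -> ~ prv T (Ex s B :: shyp S) Bot ->
  exists u : tm (sctx (next S)) s,
    prv T (shyp (next S)) (subst B (scons (P := tm _) u (fun r v => Var (there v)))).
Proof.
  revert B l; destruct S as [G H todo n]; simpl; intros B l -> q.
  unfold next, extension; simpl.
  destruct excluded_middle_informative as [|q']; [tauto|clear q']. simpl.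
  exists (Var here). apply P_hyp. left. rewrite <- (subst_var B) at 1.
  f_equal. now apply fam_ext.
Qed.

Arguments extension : simpl never.

Notation ctxs n := (sctx (stage n)).
Notation hyps n := (shyp (stage n)).

(** Each stage has its own context, so a formula over the limit is a family with one member per
    stage; [holds] is provability from some stage on. *)
Definition coherent (phi : forall m, fm (ctxs m)) n :=
  forall m, n <= m -> phi (S m) = wk_fm (phi m).
Definition holds (phi : forall m, fm (ctxs m)) :=
  exists n, forall m, n <= m -> prv T (hyps m) (phi m).

Lemma hyps_mono m A : prv T (hyps m) A -> prv T (hyps (S m)) (wk_fm A).
Proof. intro p. apply (prv_incl (prv_wk _ p)). apply next_incl. Qed.

Lemma holds_at phi n m : coherent phi n -> n <= m -> prv T (hyps m) (phi m) -> holds phi.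
Proof.
  intros c I p. exists m. intros k J. induction J as [|k J IH]; auto.
  rewrite c by lia. now apply hyps_mono.
Qed.

Lemma coherent_ren phi n m : coherent phi n -> n <= m ->
  exists rho : ren (ctxs n) (ctxs m), phi m = subst (phi n) (ren_sub rho).
Proof.
  intros c I. induction I as [|m I [rho IH]].
  - exists (fun r v => v). symmetry. apply subst_var.
  - exists (fun r v => there (rho r v)). rewrite c by lia. rewrite IH.
    unfold wk_fm. now rewrite subst_comp.
Qed.

Lemma todo_shrinks n : exists m, n <= m /\ stodo (stage m) = [] /\
  slevel (stage n) <= slevel (stage m).
Proof.
  remember (length (stodo (stage n))) as k eqn:e. revert n e.
  induction k as [|k IH]; intros n e; destruct (stodo (stage n)) as [|A l] eqn:t;
    try discriminate.
  - exists n. auto.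
  - destruct (IH (S n)) as (m & I & J & K).
    + simpl. rewrite t, length_map. now injection e.
    + exists m. simpl in K. rewrite t in K. repeat split; auto; lia.
Qed.

Lemma todo_level k n : exists m, n <= m /\ stodo (stage m) = [] /\ k <= slevel (stage m).
Proof.
  induction k as [|k (m & I & J & K)].
  - destruct (todo_shrinks n) as (m & I & J & _). exists m. repeat split; auto; lia.
  - destruct (todo_shrinks (S m)) as (m' & I' & J' & K'). exists m'.
    simpl in K'. rewrite J in K'. repeat split; auto; lia.
Qed.

Lemma todo_reached phi n k : coherent phi n ->
  nth_error (stodo (stage n)) k = Some (phi n) ->
  exists m l, n <= m /\ stodo (stage m) = phi m :: l.
Proof.
  revert n; induction k as [|k IH]; intros n c e;
    destruct (stodo (stage n)) as [|A l] eqn:t; try discriminate; simpl in e.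
  - exists n, l. injection e as <-. auto.
  - destruct (IH (S n)) as (m & l' & I & J).
    + intros m I; apply c; lia.
    + rewrite c by lia. simpl. rewrite t, nth_error_map, e. reflexivity.
    + exists m, l'. split; [lia|exact J].
Qed.

(** Fairness of the queue: the level rises without bound, so some refill happens at a level whose
    list contains every weakening of [phi n]; after that only finitely many formulas stand in
    front. *)
Lemma processed phi n : coherent phi n ->
  exists m l, n <= m /\ stodo (stage m) = phi m :: l.
Proof.
  intro c. destruct (fms_spec (phi n)) as [k Hk].
  destruct (todo_level k n) as (m & I & J & K).
  destruct (coherent_ren c I) as [rho e].
  specialize (Hk _ K _ rho). rewrite <- e in Hk.
  destruct (In_nth_error _ _ Hk) as [i Hi].
  destruct (@todo_reached phi (S m) i) as (m' & l & I' & J').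
  - intros j ?; apply c; lia.
  - rewrite c by lia. simpl. rewrite J, nth_error_map, Hi. reflexivity.
  - exists m', l. split; [lia|exact J'].
Qed.

Lemma holds_decides phi n : coherent phi n ->
  holds phi \/ holds (fun m => (~ phi m)%fm).
Proof.
  intro c. destruct (processed c) as (m & l & I & e).
  destruct (next_decides e) as [p|p]; [left|right];
    (apply holds_at with n (S m); [|lia|]).
  - exact c.
  - rewrite c by lia. exact p.
  - intros k J. now rewrite c by lia.
  - rewrite c by lia. exact p.
Qed.

Hypothesis consistent0 : ~ prv T [(~ A0)%fm] Bot.

Lemma stage_consistent n : consistent (stage n).
Proof. induction n; [exact consistent0|now apply next_consistent]. Qed.

Lemma holds_bot phi : holds phi -> holds (fun m => (~ phi m)%fm) -> False.
Proof.
  intros [n p] [m q]. apply (@stage_consistent (n + m)).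
  eapply P_impE; [apply q; lia|apply p; lia].
Qed.

(* An element of the Henkin model is a term at every stage which from some stage on
   is the weakening of its predecessor; the initial ones are arbitrary. *)
Definition eventually_wk s (e : forall m, tm (ctxs m) s) :=
  exists n, forall m, n <= m -> e (S m) = wk (e m).

(** The element named by a term of stage [k]. Its values before stage [k] are junk, which is
    harmless because only the eventual behaviour counts. *)
Fixpoint push k s (u : tm (ctxs k) s) (m : nat) : tm (ctxs m) s :=
  match PeanoNat.Nat.eq_dec k m with
  | left e => eq_rect k (fun m => tm (ctxs m) s) u m e
  | right _ => match m with O => default s | S m => wk (push u m) end
  end.

Lemma push_wk k s (u : tm (ctxs k) s) m : k <= m -> push u (S m) = wk (push u m).
Proof.
  intro I. cbn [push]. destruct PeanoNat.Nat.eq_dec; [lia|reflexivity].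
Qed.

Lemma push_id k s (u : tm (ctxs k) s) : push u k = u.
Proof.
  destruct k; cbn [push]; destruct PeanoNat.Nat.eq_dec as [e|]; try congruence;
    now rewrite (UIP_dec PeanoNat.Nat.eq_dec e eq_refl).
Qed.

Lemma eventually_wk_app s t (f : forall m, tm (ctxs m) (Arr s t)) a :
  eventually_wk f -> eventually_wk a -> eventually_wk (fun m => App (f m) (a m)).
Proof.
  intros [n p] [k q]. exists (n + k). intros m I. rewrite p, q by lia. reflexivity.
Qed.

Definition henkin : structure := {|
  dom s := {e : forall m, tm (ctxs m) s | eventually_wk e};
  app s t f a := exist _ (fun m => App (proj1_sig f m) (proj1_sig a m))
    (eventually_wk_app (proj2_sig f) (proj2_sig a));
  con s c := exist _ (fun m => Cst c) (ex_intro _ 0 (fun m _ => eq_refl));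
  less a b := holds (fun m => Lt (proj1_sig a m) (proj1_sig b m))
|}.

Definition henkin_eq (a b : dom henkin Nat) :=
  holds (fun m => Eq (proj1_sig a m) (proj1_sig b m)).

Definition at_stage {G} (rho : env henkin G) m : sub G (ctxs m) :=
  fun r v => proj1_sig (rho r v) m.

Lemma at_stage_scons G s (a : dom henkin s) (rho : env henkin G) m :
  at_stage (a :> rho) m = scons (P := tm _) (proj1_sig a m) (at_stage rho m).
Proof. now apply fam_ext. Qed.

Lemma eval_henkin G (rho : env henkin G) s (u : tm G s) m :
  proj1_sig (eval henkin rho u) m = subst_tm (at_stage rho m) u.
Proof. induction u; simpl; [reflexivity|reflexivity|now rewrite IHu1, IHu2]. Qed.

Lemma env_coherent G (rho : env henkin G) : exists n, forall m, n <= m ->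
  at_stage rho (S m) = fun r v => wk (at_stage rho m v).
Proof.
  induction G as [|s G IH].
  - exists 0. intros. apply fam_nil.
  - destruct (IH (fun r v => rho r (there v))) as [n p].
    destruct (proj2_sig (rho s here)) as [k q]. exists (n + k). intros m I.
    apply fam_ext; [apply q; lia|]. intros r v.
    exact (f_equal (fun f => f r v) (p m ltac:(lia))).
Qed.

Lemma formula_coherent G (A : fm G) (rho : env henkin G) :
  exists n, coherent (fun m => subst A (at_stage rho m)) n.
Proof.
  destruct (env_coherent rho) as [n p]. exists n. intros m I.
  rewrite p by lia. unfold wk_fm. now rewrite subst_comp.
Qed.

(** When the existential formula comes up for decision it cannot be rejected, since its negation
    would then hold too; so the variable added at that step is a witness, and [push] turns it into
    an element. *)
Lemma holds_ex_witness G s (B : fm (s :: G)) (rho : env henkin G) :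
  holds (fun m => subst (Ex s B) (at_stage rho m)) ->
  exists a : dom henkin s, holds (fun m => subst B (at_stage (a :> rho) m)).
Proof.
  intro h. destruct (env_coherent rho) as [n p].
  assert (c : coherent (fun m => subst (Ex s B) (at_stage rho m)) n).
  { intros m I. rewrite p by lia. unfold wk_fm. now rewrite subst_comp. }
  destruct (processed c) as (m & l & I & e).
  destruct (next_witness e) as [u w].
  { intro q. apply (holds_bot h).
    apply holds_at with n (S m); [intros k J; now rewrite c by lia|lia|].
    rewrite c by lia.
    exact (@hyps_mono m (~ subst (Ex s B) (at_stage rho m))%fm (P_impI q)). }
  change (tm (ctxs (S m)) s) in u. change (next (stage m)) with (stage (S m)) in w.
  assert (W : forall k, S m <= k -> push u (S k) = wk (push u k))
    by (intros; now apply push_wk).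
  exists (exist _ (push u) (ex_intro _ (S m) W)).
  apply holds_at with (S m) (S m); [|lia|].
  - intros k J. rewrite !at_stage_scons. unfold wk_fm. rewrite subst_comp. f_equal.
    apply fam_ext; [apply W; lia|]. intros r v. simpl. now rewrite p by lia.
  - rewrite at_stage_scons. cbn [proj1_sig]. rewrite push_id, p by lia.
    rewrite subst_comp in w.
    replace (scons _ _) with (fun r (v : mem (s :: G) r) => subst_tm
      (scons (P := tm (ctxs (S m))) u (fun r v => Var (there v)))
      (up (s := s) (at_stage rho m) v)); [exact w|].
    apply fam_ext; [reflexivity|]. intros r v. simpl. now rewrite subst_tm_scons_wk.
Qed.

Lemma holds_mono2 phi psi chi :
  (forall m, prv T (hyps m) (phi m) -> prv T (hyps m) (psi m) -> prv T (hyps m) (chi m)) ->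
  holds phi -> holds psi -> holds chi.
Proof. intros h [n p] [k q]. exists (n + k). intros m I. apply h; [apply p|apply q]; lia. Qed.

Lemma holds_mono phi chi :
  (forall m, prv T (hyps m) (phi m) -> prv T (hyps m) (chi m)) -> holds phi -> holds chi.
Proof. intros h [n p]. exists n. auto. Qed.

(** Every formula is decided at some stage ([dec]), which carries the cases of implication,
    disjunction and universal quantification. A universal formula decided negatively gives, by
    [prv_not_all], a witness of the negated matrix. *)
Lemma truth G (A : fm G) (rho : env henkin G) :
  sat henkin henkin_eq A rho <-> holds (fun m => subst A (at_stage rho m)).
Proof.
  assert (dec : forall G (A : fm G) (rho : env henkin G),
    holds (fun m => subst A (at_stage rho m)) \/
    holds (fun m => (~ subst A (at_stage rho m))%fm)).
  { intros D B tau. destruct (formula_coherent B tau) as [n c].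
    exact (holds_decides c). }
  assert (C : forall G s (B : fm (s :: G)) (rho : env henkin G) (a : dom henkin s) m,
    inst (subst B (up (at_stage rho m))) (proj1_sig a m)
    = subst B (at_stage (a :> rho) m)).
  { intros. now rewrite inst_up, at_stage_scons. }
  revert rho; induction A as [G a b|G a b|G|G A IHA B IHB|G A IHA B IHB|G A IHA B IHB
    |G s A IHA|G s A IHA]; intro rho; cbn [sat subst].
  - unfold henkin_eq. split; apply holds_mono; intro; now rewrite !eval_henkin.
  - simpl. split; apply holds_mono; intro; now rewrite !eval_henkin.
  - split; [tauto|]. intros [n p]. exact (stage_consistent (p n (le_n n))).
  - rewrite IHA, IHB. split.
    + intro h. destruct (dec _ A rho) as [p|p].
      * generalize (h p). revert p. apply holds_mono2. intros m _ q. apply P_impI.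
        apply (prv_incl q). intros x; simpl; auto.
      * revert p. apply holds_mono. intros m q. apply P_impI, prv_bot.
        eapply P_impE; [apply (prv_incl q); intros x; simpl; auto|apply P_hyp; now left].
    + apply holds_mono2. intro m. apply P_impE.
  - rewrite IHA, IHB. split.
    + intros [p q]. revert p q. apply holds_mono2. intro. apply P_andI.
    + intro h. split; revert h; apply holds_mono; intro m;
        [apply P_andE1|apply P_andE2].
  - rewrite IHA, IHB. split.
    + intros [p|p]; revert p; apply holds_mono; intro; [apply P_orI1|apply P_orI2].
    + intro h. destruct (dec _ A rho) as [p|p]; [now left|right]. revert h p.
      apply holds_mono2. intros m p q. eapply P_orE; [exact p| |].
      * apply prv_bot. eapply P_impE; [|apply P_hyp; now left].
        apply (prv_incl q). intros x; simpl; auto.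
      * apply P_hyp. now left.
  - split.
    + intro h. destruct (dec _ (All s A) rho) as [p|p]; [exact p|exfalso].
      destruct (@holds_ex_witness _ s (~ A)%fm rho) as [a q].
      { revert p. apply holds_mono. intro m. apply prv_not_all. }
      apply (@holds_bot (fun m => subst A (at_stage (a :> rho) m))); [|exact q].
      apply IHA, h.
    + intros h a. apply IHA. revert h. apply holds_mono. intros m p.
      rewrite <- C. now apply P_allE.
  - split.
    + intros [a h]. apply IHA in h. revert h. apply holds_mono. intros m p.
      apply P_exI with (proj1_sig a m). now rewrite C.
    + intro h. destruct (holds_ex_witness h) as [a p]. exists a. now apply IHA.
Qed.

Lemma henkin_theory A : T A -> sat henkin henkin_eq A env_nil.
Proof.
  intro h. apply truth. exists 0. intros m _.
  replace (subst A _) with (lift A : fm (ctxs m)) by (unfold lift; f_equal; apply fam_nil).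
  now apply P_ax.
Qed.

Lemma henkin_refutes : ~ sat henkin henkin_eq A0 env_nil.
Proof.
  intro h. apply truth in h. apply (holds_bot h).
  destruct (formula_coherent (~ A0)%fm env_nil) as [n c].
  apply holds_at with 0 0; [|lia|].
  - intros m _. unfold wk_fm. simpl. rewrite subst_comp. do 2 f_equal. apply fam_nil.
  - simpl. replace (at_stage env_nil 0) with (fun r (v : mem [] r) => @Var [] r v)
      by apply fam_nil.
    rewrite subst_var. apply P_hyp. now left.
Qed.

Lemma henkin_eq_equiv : Equivalence henkin_eq.
Proof.
  split.
  - intro a. exists 0. intros. apply P_refl.
  - intros a b. apply holds_mono. intros m p.
    assert (q := P_leibniz (A := Eq (Var here) (wk (proj1_sig a m))) p).
    unfold inst in q. simpl in q. rewrite !subst_tm_scons_wk, !subst_tm_var in q.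
    apply q, P_refl.
  - intros a b c. apply holds_mono2. intros m p q.
    assert (r := P_leibniz (A := Eq (wk (proj1_sig a m)) (Var here)) q).
    unfold inst in r. simpl in r. rewrite !subst_tm_scons_wk, !subst_tm_var in r. auto.
Qed.

Lemma henkin_less_eq a b c d :
  henkin_eq a b -> henkin_eq c d -> @less henkin a c -> @less henkin b d.
Proof.
  intros p q r. assert (r' : @less henkin b c).
  { revert p r. apply holds_mono2. intros m p r.
    assert (h := P_leibniz (A := Lt (Var here) (wk (proj1_sig c m))) p).
    unfold inst in h. simpl in h. rewrite !subst_tm_scons_wk, !subst_tm_var in h. auto. }
  revert q r'. apply holds_mono2. intros m q r'.
  assert (h := P_leibniz (A := Lt (wk (proj1_sig b m)) (Var here)) q).
  unfold inst in h. simpl in h. rewrite !subst_tm_scons_wk, !subst_tm_var in h. auto.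
Qed.
End Henkin.

(** * Extensional models *)

Definition extensional (M : structure) := forall s t (f g : dom M (Arr s t)),
  (forall a, app f a = app g a) -> f = g.

Section Collapse.
Variables (M : structure) (E : dom M Nat -> dom M Nat -> Prop).
Hypothesis E_equiv : Equivalence E.
Hypothesis E_less : forall a b c d, E a b -> E c d -> less a c -> less b d.

Fixpoint ext_eq s : dom M s -> dom M s -> Prop :=
  match s with
  | Nat => E
  | Arr s t => fun f g => forall a, ext_eq (app f a) (app g a)
  end.

Lemma sat_eqt G s (a b : tm G s) (rho : env M G) :
  sat M E (eqt a b) rho <-> ext_eq (eval M rho a) (eval M rho b).
Proof.
  revert G a b rho; induction s as [|s _ t IH]; intros; simpl; [tauto|].
  split; intros h c; specialize (h c); [rewrite IH in h|rewrite IH];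
    simpl in *; rewrite !eval_wk in *; exact h.
Qed.

Hypothesis E_ext : forall r t, sat M E (All (r ~> t) (All r (All r
  (eqt v1 v0 =>> eqt (v2 $ v1)%tm (v2 $ v0)%tm))))%fm env_nil.

Lemma ext_eq_equiv s : Equivalence (@ext_eq s).
Proof.
  induction s as [|s _ t IH]; [exact E_equiv|]. split.
  - intros f a. reflexivity.
  - intros f g h a. symmetry. apply h.
  - intros f g k p q a. transitivity (app g a); [apply p|apply q].
Qed.

#[local] Existing Instance ext_eq_equiv.

(** Congruence in the function is the definition of [ext_eq] at arrow types; congruence in the
    argument is the extensionality axiom. *)
Lemma ext_eq_app s t (f g : dom M (Arr s t)) a b :
  ext_eq f g -> ext_eq a b -> ext_eq (app f a) (app g b).
Proof.
  intros p q. transitivity (app g a); [apply p|].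
  assert (h := @E_ext s t g a b). simpl in h. rewrite !sat_eqt in h. auto.
Qed.

Definition collapse : structure := {|
  dom s := quot (@ext_eq s);
  app s t f a := cls (ext_eq_equiv t) (app (proj1_sig f) (proj1_sig a));
  con s c := cls (ext_eq_equiv s) (con M c);
  less a b := less (proj1_sig a) (proj1_sig b)
|}.

Definition collapsed s (a : dom M s) : dom collapse s := cls (ext_eq_equiv s) a.

Lemma collapsed_app s t (f : dom M (Arr s t)) a :
  app (collapsed f) (collapsed a) = collapsed (app f a).
Proof.
  apply cls_eq. symmetry.
  apply ext_eq_app; apply (canon_spec (ext_eq_equiv _)).
Qed.

Lemma eval_collapse G (rho : env M G) s (u : tm G s) :
  eval collapse (fun r v => collapsed (rho r v)) u = collapsed (eval M rho u).
Proof. induction u; cbn [eval]; auto. now rewrite IHu1, IHu2, collapsed_app. Qed.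

Lemma sat_collapse G (A : fm G) (rho : env M G) :
  sat collapse eq A (fun r v => collapsed (rho r v)) <-> sat M E A rho.
Proof.
  assert (C : forall G s (a : dom M s) (rho : env M G),
    (fun r v => collapsed ((a :> rho) v)) = collapsed a :> (fun r v => collapsed (rho r v)))
    by (intros; now apply fam_ext).
  assert (surj : forall s (a : dom collapse s), a = collapsed (proj1_sig a))
    by (intros; apply cls_surj).
  revert rho; induction A; intro rho; cbn [sat];
    rewrite ?eval_collapse, ?IHA1, ?IHA2; try tauto.
  - apply cls_eq.
  - split; apply E_less;
      try apply (canon_spec E_equiv); symmetry; apply (canon_spec E_equiv).
  - split; intros h a.
    + apply IHA. rewrite C. apply h.
    + rewrite (surj s a), <- C. apply IHA, h.
  - split; intros [a h].
    + exists (proj1_sig a). apply IHA. now rewrite C, <- surj.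
    + exists (collapsed a). rewrite <- C. now apply IHA.
Qed.

Lemma collapse_extensional : extensional collapse.
Proof.
  intros s t f g h. rewrite (cls_surj (ext_eq_equiv _) f), (cls_surj (ext_eq_equiv _) g).
  apply cls_eq. intro a. apply (cls_eq (ext_eq_equiv t)).
  change (collapsed (app (proj1_sig f) a) = collapsed (app (proj1_sig g) a)).
  rewrite <- !collapsed_app. unfold collapsed. rewrite <- !cls_surj. apply h.
Qed.
End Collapse.

(** [base] supplies the extensionality axioms, which make application well defined on the
    quotient. *)
Theorem completeness (T : theory) (A : fm []) :
  (forall B, RCA0omega B -> T B) ->
  (forall M, extensional M -> (forall B, T B -> sat M eq B env_nil) ->
     sat M eq A env_nil) ->
  proves T A.
Proof.
  intros base valid. unfold proves. apply P_raa. apply NNPP. intro C.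
  set (M := henkin T A). set (E := @henkin_eq T A).
  assert (ax : forall B, T B -> sat M E B env_nil) by (apply henkin_theory; exact C).
  set (equiv := @henkin_eq_equiv T A).
  assert (ext : forall r t, sat M E (All (r ~> t) (All r (All r
    (eqt v1 v0 =>> eqt (v2 $ v1)%tm (v2 $ v0)%tm))))%fm env_nil)
    by (intros; apply ax, base, RCA_ext).
  assert (K : forall B, sat (collapse equiv) eq B env_nil <-> sat M E B env_nil).
  { intro B. refine (iff_trans _ (sat_collapse equiv (@henkin_less_eq T A) ext B env_nil)).
    match goal with |- _ <-> sat _ _ _ ?f => now rewrite (fam_nil f env_nil) end. }
  apply (henkin_refutes C). apply K, valid.
  - intros s t f g. now apply collapse_extensional.
  - intros B h. apply K, ax, h.
Qed.

(** * Fraction field of an ordered semiring *)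

(** The order appears only as solvability of [x + z = y], so the field of fractions can be built
    from semiring identities. Negative values and denominators are handled in one step rather than
    by two successive quotients. *)
Record arith := {
  num :> Type;
  nzero : num; none : num;
  nadd : num -> num -> num; nmul : num -> num -> num;
  n_semiring : semi_ring_theory nzero none nadd nmul eq;
  n_cancel : forall x y z, nadd x z = nadd y z -> x = y;
  n_pos : forall x y, nadd x y = nzero -> x = nzero;
  n_total : forall x y, (exists z, nadd x z = y) \/ (exists z, nadd y z = x);
  n_one : none <> nzero;
  n_pred : forall x, x = nzero \/ exists y, x = nadd y none
}.

(* [Tri p n d] stands for the fraction (p - n) / (d + 1). *)
Record triple (A : Type) := Tri { tp : A; tn : A; td : A }.

Section Triples.
Variable A : arith.
Add Ring A_semiring : (n_semiring A).
Notation "x + y" := (nadd x y).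
Notation "x * y" := (nmul x y).
Notation "0" := (@nzero A).
Notation "1" := (@none A).
Implicit Types t u v : triple A.

Definition teq t u :=
  tp t * (td u + 1) + tn u * (td t + 1) = tp u * (td t + 1) + tn t * (td u + 1).
Definition tzero : triple A := Tri 0 0 0.
Definition tone : triple A := Tri 1 0 0.
(** The last component is [(td t + 1) * (td u + 1) - 1] written without subtraction, since
    denominators are stored minus one. *)
Definition tadd t u : triple A :=
  Tri (tp t * (td u + 1) + tp u * (td t + 1)) (tn t * (td u + 1) + tn u * (td t + 1))
    (td t * td u + td t + td u).
Definition topp t : triple A := Tri (tn t) (tp t) (td t).
Definition tmul t u : triple A :=
  Tri (tp t * tp u + tn t * tn u) (tp t * tn u + tn t * tp u) (td t * td u + td t + td u).
Definition tnonneg t := exists z, tn t + z = tp t.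

(** If the larger factor is [x + z], additive cancellation leaves [z + z * d = 0], and a sum
    vanishes only if its summands do. *)
Lemma n_cancel_mul x y d : x * (d + 1) = y * (d + 1) -> x = y.
Proof.
  assert (C : forall x z, x * (d + 1) = (x + z) * (d + 1) -> z = 0).
  { intros a z e. apply (n_pos (y := z * d)). apply n_cancel with (a * (d + 1)).
    transitivity ((a + z) * (d + 1)); [ring|]. rewrite <- e. ring. }
  intro e. destruct (n_total x y) as [[z <-]|[z <-]].
  - rewrite (C x z e). ring.
  - symmetry in e. rewrite (C y z e). ring.
Qed.

Lemma teq_equiv : Equivalence teq.
Proof.
  split; unfold teq.
  - intro t. reflexivity.
  - intros t u e. now symmetry.
  - intros t u v e f. apply n_cancel_mul with (td u).
    (* [e] scaled by the denominator of [v] and [f] scaled by that of [t] are added; the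
       contributions of [tp u] and [tn u] then occur on both sides and cancel. *)
    apply n_cancel with (tp u * (td v + 1) * (td t + 1) + tn u * (td v + 1) * (td t + 1)).
    transitivity ((tp t * (td u + 1) + tn u * (td t + 1)) * (td v + 1)
      + (tp u * (td v + 1) + tn v * (td u + 1)) * (td t + 1)); [ring|].
    rewrite e, f. ring.
Qed.

#[local] Existing Instance teq_equiv.

Lemma teq_add t t' u u' : teq t t' -> teq u u' -> teq (tadd t u) (tadd t' u').
Proof.
  unfold teq; simpl; intros e f.
  transitivity ((tp t * (td t' + 1) + tn t' * (td t + 1)) * (td u + 1) * (td u' + 1)
    + (tp u * (td u' + 1) + tn u' * (td u + 1)) * (td t + 1) * (td t' + 1)); [ring|].
  rewrite e, f. ring.
Qed.

Lemma teq_opp t t' : teq t t' -> teq (topp t) (topp t').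
Proof.
  unfold teq; simpl; intro e.
  transitivity (tp t' * (td t + 1) + tn t * (td t' + 1)); [ring|]. rewrite <- e. ring.
Qed.

Lemma teq_mul t t' u u' : teq t t' -> teq u u' -> teq (tmul t u) (tmul t' u').
Proof.
  assert (C : forall t t' u, teq t t' -> teq (tmul t u) (tmul t' u)).
  { clear. unfold teq; simpl; intros t t' u e.
    (* The two cross sums are exchanged: [e] serves forwards next to [tp u] and backwards next to
       [tn u]. *)
    transitivity ((td u + 1) * (tp u * (tp t * (td t' + 1) + tn t' * (td t + 1))
      + tn u * (tp t' * (td t + 1) + tn t * (td t' + 1)))); [ring|].
    rewrite e. rewrite <- e at 2. ring. }
  intros e f. transitivity (tmul t' u); [now apply C|].
  assert (comm : forall v w, tmul v w = tmul w v)
    by (intros; unfold tmul; f_equal; ring).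
  rewrite (comm t' u), (comm t' u'). now apply C.
Qed.

Lemma tnonneg_eq t t' : teq t t' -> tnonneg t -> tnonneg t'.
Proof.
  unfold teq, tnonneg. intros e [z h]. destruct (n_total (tn t') (tp t')) as [k|[w k]]; auto.
  assert (W : w = 0).
  { apply (n_pos (y := w * td t + z * (td t' + 1))).
    apply n_cancel with (tn t * (td t' + 1) + tp t' * (td t + 1)).
    transitivity ((tn t + z) * (td t' + 1) + (tp t' + w) * (td t + 1)); [ring|].
    rewrite h, k, e. ring. }
  exists 0. rewrite <- k, W. ring.
Qed.

Lemma tnonneg_total t : tnonneg t \/ tnonneg (topp t).
Proof. exact (n_total (tn t) (tp t)). Qed.

Lemma tnonneg_anti t : tnonneg t -> tnonneg (topp t) -> teq t tzero.
Proof.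
  unfold tnonneg, teq; simpl. intros [z h] [w k].
  assert (W : w = 0).
  { apply (n_pos (y := z)). apply n_cancel with (tn t).
    transitivity ((tn t + z) + w); [ring|]. rewrite h, k. ring. }
  rewrite <- k, W. ring.
Qed.

Lemma tnonneg_add t u : tnonneg t -> tnonneg u -> tnonneg (tadd t u).
Proof.
  unfold tnonneg; simpl. intros [z h] [w k].
  exists (z * (td u + 1) + w * (td t + 1)). rewrite <- h, <- k. ring.
Qed.

Lemma tnonneg_mul t u : tnonneg t -> tnonneg u -> tnonneg (tmul t u).
Proof.
  unfold tnonneg; simpl. intros [z h] [w k]. exists (z * w). rewrite <- h, <- k. ring.
Qed.

Lemma tinv_ex t : ~ teq t tzero -> exists u, teq (tmul u t) tone.
Proof.
  assert (C : forall t z, tn t + z = tp t -> ~ teq t tzero ->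
    exists u, teq (tmul u t) tone).
  { clear. intros t z h ne. destruct (n_pred z) as [->|[m ->]].
    - destruct ne. unfold teq; simpl. rewrite <- h. ring.
    (* Here [t] has the value [(m + 1) / (td t + 1)], and this is the reciprocal. *)
    - exists (Tri (td t + 1) 0 m). unfold teq; simpl. rewrite <- h. ring. }
  intro ne. destruct (tnonneg_total t) as [[z h]|[z h]]; [now apply C with z|].
  destruct (C (topp t) z h) as [u e].
  { intro e. apply ne.
    transitivity (topp (topp t)); [now destruct t|].
    transitivity (topp tzero); [now apply teq_opp|reflexivity]. }
  exists (topp u). revert e. unfold teq; simpl. intro e.
  etransitivity; [|etransitivity; [exact e|]]; ring.
Qed.

Definition Frac := quot teq.
Definition fr (t : triple A) : Frac := cls teq_equiv t.

Lemma fr_eq t u : fr t = fr u <-> teq t u.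
Proof. apply cls_eq. Qed.

Lemma fr_surj (a : Frac) : exists t, a = fr t.
Proof. exists (proj1_sig a). apply cls_surj. Qed.

Definition fadd (a b : Frac) : Frac := fr (tadd (proj1_sig a) (proj1_sig b)).
Definition fopp (a : Frac) : Frac := fr (topp (proj1_sig a)).
Definition fmul (a b : Frac) : Frac := fr (tmul (proj1_sig a) (proj1_sig b)).
Definition fnonneg (a : Frac) : bool :=
  if excluded_middle_informative (tnonneg (proj1_sig a)) then true else false.
(** The value at zero is pinned to zero, as the MathComp field structure demands. *)
Definition Finv (a : Frac) : Frac :=
  epsilon (inhabits (fr tzero))
    (fun b => (a = fr tzero -> b = fr tzero) /\ (a <> fr tzero -> fmul b a = fr tone)).

Lemma fr_canon t : teq t (proj1_sig (fr t)).
Proof. apply (canon_spec teq_equiv). Qed.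

Lemma fadd_fr t u : fadd (fr t) (fr u) = fr (tadd t u).
Proof. symmetry. apply fr_eq, teq_add; apply fr_canon. Qed.

Lemma fopp_fr t : fopp (fr t) = fr (topp t).
Proof. symmetry. apply fr_eq, teq_opp, fr_canon. Qed.

Lemma fmul_fr t u : fmul (fr t) (fr u) = fr (tmul t u).
Proof. symmetry. apply fr_eq, teq_mul; apply fr_canon. Qed.

Lemma fnonneg_fr t : fnonneg (fr t) = true <-> tnonneg t.
Proof.
  assert (e := fr_canon t). unfold fnonneg.
  destruct excluded_middle_informative as [h|h]; split; intro k; auto; try discriminate.
  - now apply tnonneg_eq with (2 := h), teq_equiv.
  - destruct h. now apply tnonneg_eq with (2 := k).
Qed.

Lemma faddA a b c : fadd a (fadd b c) = fadd (fadd a b) c.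
Proof.
  destruct (fr_surj a) as [t ->], (fr_surj b) as [u ->], (fr_surj c) as [v ->].
  rewrite !fadd_fr. apply fr_eq. unfold teq; simpl. ring.
Qed.

Lemma faddC a b : fadd a b = fadd b a.
Proof.
  destruct (fr_surj a) as [t ->], (fr_surj b) as [u ->].
  rewrite !fadd_fr. apply fr_eq. unfold teq; simpl. ring.
Qed.

Lemma fadd0 a : fadd (fr tzero) a = a.
Proof.
  destruct (fr_surj a) as [t ->]. rewrite !fadd_fr. apply fr_eq. unfold teq; simpl. ring.
Qed.

Lemma faddN a : fadd (fopp a) a = fr tzero.
Proof.
  destruct (fr_surj a) as [t ->]. rewrite fopp_fr, fadd_fr. apply fr_eq.
  unfold teq; simpl. ring.
Qed.

Lemma fmulA a b c : fmul a (fmul b c) = fmul (fmul a b) c.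
Proof.
  destruct (fr_surj a) as [t ->], (fr_surj b) as [u ->], (fr_surj c) as [v ->].
  rewrite !fmul_fr. apply fr_eq. unfold teq; simpl. ring.
Qed.

Lemma fmulC a b : fmul a b = fmul b a.
Proof.
  destruct (fr_surj a) as [t ->], (fr_surj b) as [u ->].
  rewrite !fmul_fr. apply fr_eq. unfold teq; simpl. ring.
Qed.

Lemma fmul1 a : fmul (fr tone) a = a.
Proof.
  destruct (fr_surj a) as [t ->]. rewrite !fmul_fr. apply fr_eq. unfold teq; simpl. ring.
Qed.

Lemma fmulD a b c : fmul (fadd a b) c = fadd (fmul a c) (fmul b c).
Proof.
  destruct (fr_surj a) as [t ->], (fr_surj b) as [u ->], (fr_surj c) as [v ->].
  rewrite fadd_fr, !fmul_fr, fadd_fr. apply fr_eq. unfold teq; simpl. ring.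
Qed.

Lemma fone_neq0 : fr tone <> fr tzero.
Proof.
  intro e. apply fr_eq in e. unfold teq in e; simpl in e.
  apply (n_one (a := A)). transitivity (1 * (0 + 1) + 0 * (0 + 1)); [ring|].
  rewrite e. ring.
Qed.

Lemma Finv_spec a :
  (a = fr tzero -> Finv a = fr tzero) /\ (a <> fr tzero -> fmul (Finv a) a = fr tone).
Proof.
  unfold Finv. apply epsilon_spec.
  destruct (classic (a = fr tzero)) as [e|e]; [now exists (fr tzero)|].
  destruct (fr_surj a) as [t ->]. destruct (@tinv_ex t) as [u h].
  - intro k. apply e. now apply fr_eq.
  - exists (fr u). split; [tauto|]. intros _. rewrite fmul_fr. now apply fr_eq.
Qed.

Lemma fnonneg_add a b :
  fnonneg a = true -> fnonneg b = true -> fnonneg (fadd a b) = true.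
Proof.
  destruct (fr_surj a) as [t ->], (fr_surj b) as [u ->].
  rewrite fadd_fr, !fnonneg_fr. apply tnonneg_add.
Qed.

Lemma fnonneg_mul a b :
  fnonneg a = true -> fnonneg b = true -> fnonneg (fmul a b) = true.
Proof.
  destruct (fr_surj a) as [t ->], (fr_surj b) as [u ->].
  rewrite fmul_fr, !fnonneg_fr. apply tnonneg_mul.
Qed.

Lemma fnonneg_anti a : fnonneg a = true -> fnonneg (fopp a) = true -> a = fr tzero.
Proof.
  destruct (fr_surj a) as [t ->]. rewrite fopp_fr, !fnonneg_fr, fr_eq. apply tnonneg_anti.
Qed.

Lemma fnonneg_total a : fnonneg a = true \/ fnonneg (fopp a) = true.
Proof.
  destruct (fr_surj a) as [t ->]. rewrite fopp_fr, !fnonneg_fr. apply tnonneg_total.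
Qed.

Definition of_num (x : A) : Frac := fr (Tri x 0 0).

Lemma of_num_add x y : of_num (x + y) = fadd (of_num x) (of_num y).
Proof. unfold of_num. rewrite fadd_fr. apply fr_eq. unfold teq; simpl. ring. Qed.

Lemma of_num_mul x y : of_num (x * y) = fmul (of_num x) (of_num y).
Proof. unfold of_num. rewrite fmul_fr. apply fr_eq. unfold teq; simpl. ring. Qed.

Lemma of_num_inj x y : of_num x = of_num y -> x = y.
Proof.
  intro e. apply fr_eq in e. unfold teq in e; simpl in e.
  transitivity (x * (0 + 1) + 0 * (0 + 1)); [ring|]. rewrite e. ring.
Qed.

Lemma of_num_le x y :
  fnonneg (fadd (of_num y) (fopp (of_num x))) = true <-> exists z, x + z = y.
Proof.
  unfold of_num. rewrite fopp_fr, fadd_fr, fnonneg_fr. unfold tnonneg; simpl.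
  split; intros [z h]; exists z.
  - transitivity (0 * (0 + 1) + x * (0 + 1) + z); [ring|]. rewrite h. ring.
  - rewrite <- h. ring.
Qed.

Lemma fr_mul_den p n d :
  fmul (fr (Tri p n d)) (of_num (d + 1)) = fadd (of_num p) (fopp (of_num n)).
Proof.
  unfold of_num. rewrite fopp_fr, fadd_fr, fmul_fr. apply fr_eq. unfold teq; simpl. ring.
Qed.
End Triples.

(** * The fractions as an ordered field *)

Section FracInstances.
Import all_boot all_order all_algebra.
Import GRing.Theory Num.Theory Order.TTheory.
Variable A : arith.
Local Open Scope ring_scope.
HB.instance Definition _ := boolp.gen_eqMixin (Frac A).
HB.instance Definition _ := boolp.gen_choiceMixin (Frac A).
HB.instance Definition _ :=
  GRing.isZmodule.Build (Frac A) (@faddA A) (@faddC A) (@fadd0 A) (@faddN A).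

Fact frac_one_neq0 : fr (@tone A) != 0.
Proof. by apply/eqP; exact: fone_neq0. Qed.
HB.instance Definition _ := GRing.Zmodule_isComNzRing.Build (Frac A)
  (@fmulA A) (@fmulC A) (@fmul1 A) (@fmulD A) frac_one_neq0.

Fact frac_mulVf (a : Frac A) : a != 0 -> Finv a * a = 1.
Proof. by move=> /eqP; apply: (Finv_spec a).2. Qed.
Fact frac_invr0 : Finv (0 : Frac A) = 0.
Proof. exact: (Finv_spec _).1. Qed.
HB.instance Definition _ := GRing.ComNzRing_isField.Build (Frac A) frac_mulVf frac_invr0.

Definition fle (a b : Frac A) := fnonneg (b - a).
Definition fnorm (a : Frac A) := if fnonneg a then a else - a.

Fact fle0_add (a b : Frac A) : fle 0 a -> fle 0 b -> fle 0 (a + b).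
Proof. by rewrite /fle !subr0; apply: fnonneg_add. Qed.
Fact fle0_mul (a b : Frac A) : fle 0 a -> fle 0 b -> fle 0 (a * b).
Proof. by rewrite /fle !subr0; apply: fnonneg_mul. Qed.
Fact fle0_anti (a : Frac A) : fle 0 a -> fle a 0 -> a = 0.
Proof. by rewrite /fle subr0 sub0r; apply: fnonneg_anti. Qed.
Fact fsub_ge0 (a b : Frac A) : fle 0 (b - a) = fle a b.
Proof. by rewrite /fle subr0. Qed.
Fact fle0_total (a : Frac A) : fle 0 a || fle a 0.
Proof. by rewrite /fle subr0 sub0r; apply/orP; apply: fnonneg_total. Qed.
Fact fnormN (a : Frac A) : fnorm (- a) = fnorm a.
Proof.
rewrite /fnorm; case: ifP => h; case: ifP => k; rewrite ?opprK //.
  by rewrite (fnonneg_anti k h) oppr0.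
by have [|] := fnonneg_total a; rewrite (h, k).
Qed.
Fact fge0_norm (a : Frac A) : fle 0 a -> fnorm a = a.
Proof. by rewrite /fle /fnorm subr0 => ->. Qed.

HB.instance Definition _ := Num.IntegralDomain_isLeReal.Build (Frac A)
  fle0_add fle0_mul fle0_anti fsub_ge0 fle0_total fnormN fge0_norm (fun _ _ => erefl).

Lemma numD (x y : A) : of_num (nadd x y) = of_num x + of_num y.
Proof. exact: of_num_add. Qed.
Lemma numM (x y : A) : of_num (nmul x y) = of_num x * of_num y.
Proof. exact: of_num_mul. Qed.
Lemma num_le (x y : A) : of_num x <= of_num y <-> exists z, nadd x z = y.
Proof. exact: of_num_le. Qed.
Lemma num_ge0 (x : A) : 0 <= of_num x.
Proof.
by apply/(@num_le (nzero A)); exists x; apply: (SRadd_0_l (n_semiring A)).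
Qed.

Lemma fr_div (p n d : A) :
  fr (Tri p n d) = (of_num p - of_num n) / (of_num d + 1).
Proof.
have d0 : of_num d + 1 != 0 by rewrite gt_eqF // ltr_wpDl ?num_ge0.
apply: (mulIf d0); rewrite divfK //.
by have := fr_mul_den p n d; rewrite numD.
Qed.
End FracInstances.

(** * Arithmetic in a model *)

Lemma sat_eqt_ext (M : structure) (ext : extensional M) G s (a b : tm G s) (rho : env M G) :
  sat M eq (eqt a b) rho <-> eval M rho a = eval M rho b.
Proof.
  rewrite sat_eqt.
  assert (C : forall s (x y : dom M s), @ext_eq M eq s x y <-> x = y).
  { clear - ext. induction s as [|s _ t IH]; intros x y; simpl; [tauto|]. split.
    - intro h. apply ext. intro a. now apply IH.
    - intros -> a. now apply IH. }
  apply C.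
Qed.

Record model := {
  model_structure :> structure;
  model_ext : extensional model_structure;
  base : forall B, RCA0omega B -> sat model_structure eq B env_nil;
  ind : forall B, IND B -> sat model_structure eq B env_nil
}.

Section Model.
Variable M : model.

Notation N := (dom M Nat).
Notation ev := (eval M).
Notation st := (sat M eq).
Implicit Types x y z m n : N.

Lemma app_Pi r t (a : dom M r) (b : dom M t) : app (app (con M Pi) a) b = a.
Proof.
  assert (h := base M (RCA_Pi r t)). cbn [sat] in h. specialize (h a b).
  now rewrite (sat_eqt_ext (@model_ext M)) in h.
Qed.

Lemma app_Sigma d r t (a : dom M (d ~> r ~> t)) b c :
  app (app (app (con M Sigma) a) b) c = app (app a c) (app b c).
Proof.
  assert (h := base M (RCA_Sigma d r t)). cbn [sat] in h. specialize (h a b c).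
  now rewrite (sat_eqt_ext (@model_ext M)) in h.
Qed.

Lemma eval_abs D G s (f : forall r, mem D r -> tm G (s ~> r)) (rho : env M G) a
    t (u : tm D t) :
  app (ev rho (abs f u)) a = ev (fun r v => app (ev rho (f r v)) a) u.
Proof.
  induction u; cbn [abs eval]; auto.
  - now rewrite app_Pi.
  - now rewrite app_Sigma, IHu1, IHu2.
Qed.

Lemma eval_lam G s t (u : tm (s :: G) t) (rho : env M G) a :
  app (ev rho (lam u)) a = ev (a :> rho) u.
Proof.
  unfold lam. rewrite eval_abs. f_equal. apply fam_ext; cbn.
  - now rewrite app_Sigma, !app_Pi.
  - intros r v. now rewrite app_Pi.
Qed.

Lemma eval_closed G (rho : env M G) t (u : tm [] t) :
  ev rho (subst_tm no_var u) = ev env_nil u.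
Proof. rewrite eval_subst. f_equal. apply fam_nil. Qed.

Lemma eval_fun1 (b : tm [0]%ty 0) G (rho : env M G) (u : tm G 0) :
  ev rho (fun1 b u) = ev (ev rho u :> env_nil) b.
Proof. unfold fun1. cbn [eval]. now rewrite eval_closed, eval_lam. Qed.

Lemma eval_fun2 (b : tm [0; 0]%ty 0) G (rho : env M G) (u v : tm G 0) :
  ev rho (fun2 b u v) = ev (ev rho v :> ev rho u :> env_nil) b.
Proof. unfold fun2. cbn [eval]. now rewrite eval_closed, !eval_lam. Qed.

Definition plus_M (a b : N) : N := app (app (con M Plus) a) b.
Definition times_M (a b : N) : N := app (app (con M Times) a) b.
Definition zero_M : N := con M Zero.
Definition one_M : N := con M One.
Definition recur (f : dom M (0 ~> 0 ~> 0)) (m n : N) : N :=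
  app (app (app (con M Rec0) f) m) n.

Lemma recur_0 f m : recur f m zero_M = m.
Proof. exact (base M RCA_Rec_0 f m). Qed.

Lemma recur_S f m n : recur f m (plus_M n one_M) = app (app f n) (recur f m n).
Proof. exact (base M RCA_Rec_S f m n). Qed.

Definition iter_body (b : tm [0; 0]%ty 0) : dom M (0 ~> 0 ~> 0) := ev env_nil (lam (lam b)).

Lemma eval_primrec b G (rho : env M G) (u v : tm G 0) :
  ev rho (primrec b u v) = recur (iter_body b) (ev rho u) (ev rho v).
Proof. unfold primrec, recur. cbn [eval]. now rewrite eval_closed. Qed.

Lemma iter_body_app b i a : app (app (iter_body b) i) a = ev (a :> i :> env_nil) b.
Proof. unfold iter_body. now rewrite !eval_lam. Qed.

Lemma semiring_sat A : In A ordered_semiring -> forall rho : env M _, st A rho.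
Proof. intro h. apply sat_closure, base, RCA_semiring, h. Qed.

Ltac semiring := unfold ordered_semiring; simpl; tauto.

Notation "[ x ; y ; z ]" := (x :> y :> z :> env_nil).

Lemma plusA x y z : plus_M (plus_M x y) z = plus_M x (plus_M y z).
Proof.
  apply (@semiring_sat ((v0 + v1) + v2 == v0 + (v1 + v2))%fm) with (rho := [x; y; z]).
  semiring.
Qed.
Lemma plusC x y : plus_M x y = plus_M y x.
Proof.
  apply (@semiring_sat (v0 + v1 == v1 + v0)%fm) with (rho := [x; y; y]). semiring.
Qed.
Lemma plus0 x : plus_M x zero_M = x.
Proof. apply (@semiring_sat (v0 + 0 == v0)%fm) with (rho := [x; x; x]). semiring. Qed.
Lemma timesA x y z : times_M (times_M x y) z = times_M x (times_M y z).
Proof.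
  apply (@semiring_sat ((v0 * v1) * v2 == v0 * (v1 * v2))%fm) with (rho := [x; y; z]).
  semiring.
Qed.
Lemma timesC x y : times_M x y = times_M y x.
Proof.
  apply (@semiring_sat (v0 * v1 == v1 * v0)%fm) with (rho := [x; y; y]). semiring.
Qed.
Lemma times1 x : times_M x one_M = x.
Proof. apply (@semiring_sat (v0 * 1 == v0)%fm) with (rho := [x; x; x]). semiring. Qed.
Lemma times0 x : times_M x zero_M = zero_M.
Proof. apply (@semiring_sat (v0 * 0 == 0)%fm) with (rho := [x; x; x]). semiring. Qed.
Lemma times_plus x y z : times_M x (plus_M y z) = plus_M (times_M x y) (times_M x z).
Proof.
  apply (@semiring_sat (v0 * (v1 + v2) == v0 * v1 + v0 * v2)%fm) with (rho := [x; y; z]).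
  semiring.
Qed.
Lemma less_irrefl x : ~ less x x.
Proof. apply (@semiring_sat (~ (v0 < v0))%fm) with (rho := [x; x; x]). semiring. Qed.
Lemma less_trans x y z : less x y -> less y z -> less x z.
Proof.
  apply (@semiring_sat (v0 < v1 =>> v1 < v2 =>> v0 < v2)%fm) with (rho := [x; y; z]).
  semiring.
Qed.
Lemma less_trichotomy x y : less x y \/ x = y \/ less y x.
Proof.
  apply (@semiring_sat (v0 < v1 \/ v0 == v1 \/ v1 < v0)%fm) with (rho := [x; y; y]).
  semiring.
Qed.
Lemma less_plus x y z : less x y -> less (plus_M x z) (plus_M y z).
Proof.
  apply (@semiring_sat (v0 < v1 =>> v0 + v2 < v1 + v2)%fm) with (rho := [x; y; z]).
  semiring.
Qed.
Lemma less_0_1 : less zero_M one_M.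
Proof.
  apply (@semiring_sat (0 < 1)%fm) with (rho := [zero_M; zero_M; zero_M]). semiring.
Qed.

(* The formula [A] and its parameters [rho] witness that [P] is definable. *)
Lemma induct (P : N -> Prop) G (A : fm (0%ty :: G)) (rho : env M G) :
  (forall n, st A (n :> rho) = P n) ->
  P zero_M -> (forall n, P n -> P (plus_M n one_M)) -> forall n, P n.
Proof.
  intros e p q. assert (h := ind M (IND_inst A)).
  assert (k := proj1 (sat_closure eq (induction A)) h rho).
  unfold induction in k. cbn [sat] in k. rewrite sat_inst in k.
  intro n. rewrite <- e. apply k.
  - change (sat M eq A (zero_M :> rho)). now rewrite e.
  - intros m. rewrite sat_subst.
    assert (E : (fun r (v : mem (0%ty :: G) r) => ev (m :> rho)
      (scons (P := tm (0%ty :: G)) (v0 + 1)%tm (fun r v => Var (there v)) v))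
      = plus_M m one_M :> rho) by now apply fam_ext.
    rewrite E, !e. apply q.
Qed.

Notation fm1 A := (A%fm : fm [0%ty]).
(** The formula is written by hand; [eq_refl] checks that its satisfaction is convertible to the
    goal. *)
Ltac induction_on n A rho :=
  revert n;
  match goal with |- forall n, @?P n =>
    apply (@induct P _ A rho (fun _ => eq_refl)); [|intros n]
  end.

Lemma pred_exists n : n = zero_M \/ exists m, n = plus_M m one_M.
Proof.
  induction_on n (fm1 (v0 == 0 \/ Ex 0 (v1 == v0 + 1))) (@env_nil M); eauto.
Qed.

Lemma zero_plus x : plus_M zero_M x = x.
Proof. now rewrite plusC, plus0. Qed.

Lemma less_succ n : less n (plus_M n one_M).
Proof. rewrite <- (zero_plus n) at 1. rewrite (plusC n). apply less_plus, less_0_1. Qed.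

Lemma zero_less_succ n : less zero_M (plus_M n one_M).
Proof.
  induction_on n (fm1 (0 < v0 + 1)) (@env_nil M).
  - apply less_succ.
  - intro h. apply less_trans with (1 := h), less_succ.
Qed.

Lemma plus_zero x y : plus_M x y = zero_M -> x = zero_M.
Proof.
  intro e. destruct (pred_exists x) as [h|[m ->]]; auto.
  destruct (@less_irrefl zero_M). rewrite <- e at 2.
  rewrite plusA, (plusC one_M), <- plusA. apply zero_less_succ.
Qed.

Lemma plus_cancel x y z : plus_M x z = plus_M y z -> x = y.
Proof.
  intro e. destruct (less_trichotomy x y) as [h|[h|h]]; auto;
    destruct (@less_irrefl (plus_M y z)); [rewrite <- e at 1|rewrite <- e at 2];
    now apply less_plus.
Qed.

(** The semiring axioms do not provide differences; induction does, and the existence of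
    predecessors handles the step at which the sign of the difference changes. *)
Lemma plus_total x y : (exists z, plus_M x z = y) \/ (exists z, plus_M y z = x).
Proof.
  induction_on y ((Ex 0 (v2 + v0 == v1) \/ Ex 0 (v1 + v0 == v2))%fm : fm [0; 0]%ty)
    (x :> @env_nil M).
  - right. exists x. now rewrite plusC, plus0.
  - intros [[z <-]|[z <-]].
    + left. exists (plus_M z one_M). now rewrite plusA.
    + destruct (pred_exists z) as [->|[m ->]].
      * left. exists one_M. now rewrite plus0.
      * right. exists m. now rewrite plusA, (plusC one_M).
Qed.

Lemma less_spec x y : less x y <-> exists z, plus_M x (plus_M z one_M) = y.
Proof.
  assert (C : forall x z, less x (plus_M x (plus_M z one_M))).
  { intros a z. rewrite plusC. rewrite <- (zero_plus a) at 1.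
    apply less_plus, zero_less_succ. }
  split; [|intros [z <-]; apply C].
  intro h. destruct (plus_total x y) as [[z <-]|[z <-]];
    (destruct (pred_exists z) as [->|[m ->]]; [rewrite plus0 in h; now apply less_irrefl in h|]).
  - eauto.
  - destruct (@less_irrefl y). apply less_trans with (2 := h). apply C.
Qed.

Lemma plus_semiring : semi_ring_theory zero_M one_M plus_M times_M eq.
Proof.
  split; intros.
  - apply zero_plus.
  - apply plusC.
  - symmetry. apply plusA.
  - now rewrite timesC, times1.
  - now rewrite timesC, times0.
  - apply timesC.
  - symmetry. apply timesA.
  - now rewrite timesC, times_plus, (timesC p n), (timesC p m).
Qed.

Lemma one_neq_zero : one_M <> zero_M.
Proof. intro e. apply (@less_irrefl zero_M). rewrite <- e at 2. apply less_0_1. Qed.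

Definition model_arith : arith := {|
  n_semiring := plus_semiring; n_cancel := plus_cancel; n_pos := plus_zero;
  n_total := plus_total; n_one := one_neq_zero; n_pred := pred_exists
|}.

End Model.
(** * Rational and real numbers in a model *)

Section Numbers.
Import all_boot all_order all_algebra ring lra.
Import GRing.Theory Num.Theory Order.TTheory.
Import Defs.
Local Open Scope ring_scope.

Lemma add_fractions (F : realFieldType) (a b c d e f : F) : a != 0 -> b != 0 ->
  (c * b + d * a - (e * b + f * a)) / (a * b) = (c - e) / a + (d - f) / b.
Proof. by move=> a0 b0; field; rewrite ?a0 ?b0. Qed.

Lemma inv_double (F : realFieldType) (a : F) : (a + a)^-1 = a^-1 / 2.
Proof. have -> : a + a = a * 2 by ring. by rewrite invfM. Qed.

Lemma one_minus_fraction (F : realFieldType) (a : F) : 0 <= a ->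
  `|a / (a + 1) - 1| = (a + 1)^-1.
Proof.
move=> a0; have h : 0 < a + 1 by lra.
have -> : a / (a + 1) - 1 = - (a + 1)^-1 by field; rewrite gt_eqF.
by rewrite normrN gtr0_norm // invr_gt0.
Qed.

Lemma fraction_le (F : realFieldType) (a b : F) : 0 <= a -> a <= b ->
  a / (a + 1) <= b / (b + 1).
Proof.
move=> a0 ab; have a1 : 0 < a + 1 by lra. have b1 : 0 < b + 1 by lra.
by rewrite ler_pdivrMr // mulrAC ler_pdivlMr //; lra.
Qed.

Lemma inv_succ_lt (F : realFieldType) (c k a : F) : 0 < c -> 1 <= c * k -> k <= a ->
  (a + 1)^-1 < c.
Proof.
move=> c0 ck ka; have k0 : 0 < k by rewrite -(pmulr_rgt0 _ c0); lra.
have : c * k <= c * a by rewrite ler_pM2l.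
have a1 : 0 < a + 1 by lra.
by rewrite -div1r ltr_pdivrMr //; lra.
Qed.

Variable M : model.
Notation N := (dom M Nat).
Notation K := (Frac (model_arith M)).
Notation ev := (eval M).
Notation st := (sat M eq).
Implicit Types x y z m n i j : N.

Definition num_of (x : N) : K := @of_num (model_arith M) x.
Local Notation "x %:K" := (num_of x) (at level 2, left associativity, format "x %:K").

Lemma numKD x y : (plus_M x y)%:K = x%:K + y%:K. Proof. exact: numD. Qed.
Lemma numKM x y : (times_M x y)%:K = x%:K * y%:K. Proof. exact: numM. Qed.
Lemma numK0 : (zero_M M)%:K = 0. Proof. by []. Qed.
Lemma numK1 : (one_M M)%:K = 1. Proof. by []. Qed.
Lemma num_eq x y : x = y -> x%:K = y%:K. Proof. by move=> ->. Qed.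
Lemma numK_inj x y : x%:K = y%:K -> x = y.
Proof. exact: (@of_num_inj (model_arith M)). Qed.
Lemma numK_ge0 x : 0 <= x%:K. Proof. exact: num_ge0. Qed.
Definition numKE := (numKD, numKM, numK0, numK1).

Lemma num_leP x y : x%:K <= y%:K <-> exists z : N, plus_M x z = y.
Proof. exact: num_le. Qed.

(** Turns order statements of the model into inequalities of the field, where [lra] applies. *)
Lemma lessE x y : less x y <-> x%:K < y%:K.
Proof.
rewrite less_spec; split => [[z <-]|h].
  by rewrite !numKE; have := numK_ge0 z; lra.
have /num_leP [z e] : x%:K <= y%:K by exact: ltW.
have [z0|[w zw]] := pred_exists z.
  by move: h; rewrite -e z0 plus0 ltxx.
by exists w; rewrite -zw.
Qed.

(** Discreteness, which linear arithmetic over the field cannot supply. *)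
Lemma num_succ_le x y : x%:K < y%:K -> x%:K + 1 <= y%:K.
Proof.
move=> /lessE /less_spec [z <-]; rewrite !numKE; have := numK_ge0 z; lra.
Qed.

Lemma num_le_or_eq x y : (less x y \/ x = y) <-> x%:K <= y%:K.
Proof.
split=> [[/lessE /ltW //|-> //]|]; rewrite le_eqVlt => /orP [/eqP /numK_inj|/lessE]; auto.
Qed.

Ltac induction_on n A rho :=
  revert n;
  match goal with |- forall n, @?P n =>
    apply (@induct M P _ A rho (fun _ => Logic.eq_refl)); [|intros n]
  end.
Notation fm1 A := (A%fm : fm [Nat]).
Notation fm2 A := (A%fm : fm [Nat; Nat]).
Notation enil := (@env_nil M).

(** * Arithmetical functions and Cantor pairing *)

Definition pred_M n : N := ev (n :> enil) (predN v0).
Definition monus_M m n : N := ev (n :> m :> enil) (monus v1 v0).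
Definition is_zero_M n : N := ev (n :> enil) (is_zero v0).
Definition pow2_M n : N := ev (n :> enil) (pow2 v0).
Definition triangle_M n : N := ev (n :> enil) (triangle v0).
Definition diagonal_M n : N := ev (n :> enil) (diagonal v0).

Lemma eval_plus G (rho : env M G) (u v : tm G 0) :
  ev rho (u + v)%tm = plus_M (ev rho u) (ev rho v).
Proof. by []. Qed.
Lemma eval_times G (rho : env M G) (u v : tm G 0) :
  ev rho (u * v)%tm = times_M (ev rho u) (ev rho v).
Proof. by []. Qed.
Lemma eval_predN G (rho : env M G) (u : tm G 0) :
  ev rho (predN u) = pred_M (ev rho u).
Proof. by rewrite /pred_M /predN !eval_primrec. Qed.
Lemma eval_monus G (rho : env M G) (u v : tm G 0) :
  ev rho (monus u v) = monus_M (ev rho u) (ev rho v).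
Proof. by rewrite /monus_M /monus !eval_primrec. Qed.
Lemma eval_is_zero G (rho : env M G) (u : tm G 0) :
  ev rho (is_zero u) = is_zero_M (ev rho u).
Proof. by rewrite /is_zero_M /is_zero !eval_primrec. Qed.
Lemma eval_pow2 G (rho : env M G) (u : tm G 0) :
  ev rho (pow2 u) = pow2_M (ev rho u).
Proof. by rewrite /pow2_M /pow2 !eval_primrec. Qed.
Lemma eval_triangle G (rho : env M G) (u : tm G 0) :
  ev rho (triangle u) = triangle_M (ev rho u).
Proof. by rewrite /triangle_M /triangle !eval_primrec. Qed.
Lemma eval_diagonal G (rho : env M G) (u : tm G 0) :
  ev rho (diagonal u) = diagonal_M (ev rho u).
Proof. by rewrite /diagonal_M /diagonal !eval_primrec. Qed.

Lemma pred_M0 : pred_M (zero_M M) = zero_M M.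
Proof. by rewrite /pred_M /predN eval_primrec recur_0. Qed.
Lemma pred_MS n : pred_M (plus_M n (one_M M)) = n.
Proof. by rewrite /pred_M /predN eval_primrec recur_S iter_body_app. Qed.
Lemma monus_M0 m : monus_M m (zero_M M) = m.
Proof. by rewrite /monus_M /monus eval_primrec recur_0. Qed.
Lemma monus_MS m n : monus_M m (plus_M n (one_M M)) = pred_M (monus_M m n).
Proof.
by rewrite /monus_M /monus !eval_primrec recur_S iter_body_app eval_predN.
Qed.
Lemma is_zero_M0 : is_zero_M (zero_M M) = one_M M.
Proof. by rewrite /is_zero_M /is_zero eval_primrec recur_0. Qed.
Lemma is_zero_MS n : is_zero_M (plus_M n (one_M M)) = zero_M M.
Proof. by rewrite /is_zero_M /is_zero eval_primrec recur_S iter_body_app. Qed.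
Lemma pow2_M0 : pow2_M (zero_M M) = one_M M.
Proof. by rewrite /pow2_M /pow2 eval_primrec recur_0. Qed.
Lemma pow2_MS n : pow2_M (plus_M n (one_M M)) = plus_M (pow2_M n) (pow2_M n).
Proof. by rewrite /pow2_M /pow2 !eval_primrec recur_S iter_body_app. Qed.
Lemma triangle_M0 : triangle_M (zero_M M) = zero_M M.
Proof. by rewrite /triangle_M /triangle eval_primrec recur_0. Qed.
Lemma triangle_MS n :
  triangle_M (plus_M n (one_M M)) = plus_M (triangle_M n) (plus_M n (one_M M)).
Proof. by rewrite /triangle_M /triangle !eval_primrec recur_S iter_body_app. Qed.
Lemma diagonal_M0 : diagonal_M (zero_M M) = zero_M M.
Proof. by rewrite /diagonal_M /diagonal eval_primrec recur_0. Qed.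
Lemma diagonal_MS n : diagonal_M (plus_M n (one_M M)) = plus_M (diagonal_M n)
  (is_zero_M (monus_M (triangle_M (plus_M (diagonal_M n) (one_M M))) (plus_M n (one_M M)))).
Proof.
rewrite /diagonal_M /diagonal !eval_primrec recur_S iter_body_app.
by rewrite eval_plus eval_is_zero eval_monus eval_triangle.
Qed.

Lemma num_predM n : (pred_M n)%:K = if 0 < n%:K then n%:K - 1 else 0.
Proof.
have [->|[m ->]] := pred_exists n; first by rewrite pred_M0 numKE ltxx.
by rewrite pred_MS !numKE ltr_wpDl ?numK_ge0 // addrK.
Qed.

Lemma num_monus m n : (monus_M m n)%:K = if m%:K <= n%:K then 0 else m%:K - n%:K.
Proof.
(* Induction needs a formula of the language, so the case distinction is first restated with [less]
   and addition in place of field values. *)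
suff : less n m /\ plus_M (monus_M m n) n = m \/ ~ less n m /\ monus_M m n = zero_M M.
  rewrite !lessE leNgt => -[[-> {2}<-]|[/negP/negbTE -> ->]]; rewrite /= ?numKE //.
  by rewrite addrK.
induction_on n (fm2 (v0 < v1 /\ monus v1 v0 + v0 == v1 \/ ~ (v0 < v1) /\ monus v1 v0 == 0))
  (m :> enil).
  rewrite monus_M0 plus0; have [->|[w ->]] := pred_exists m.
    by right; split=> //; apply: less_irrefl.
  by left; split=> //; apply: zero_less_succ.
rewrite monus_MS => -[[h e]|[h ->]]; last first.
  right; split; last exact: pred_M0.
  by move: h; rewrite !lessE !numKE; lra.
have [z0|[w zw]] := pred_exists (monus_M m n).
  by move: h; rewrite -e z0 zero_plus => /less_irrefl.
rewrite zw pred_MS; rewrite zw in e; have [w0|[w' ww']] := pred_exists w.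
  right; split=> //; rewrite -e w0 lessE !numKE; lra.
left; split; last by apply: numK_inj; rewrite -e !numKE; ring.
by rewrite -e ww' lessE !numKE; have := numK_ge0 w'; lra.
Qed.

Lemma is_zero_cases n : n = zero_M M /\ is_zero_M n = one_M M \/
  (0 < n%:K /\ is_zero_M n = zero_M M).
Proof.
have [->|[m ->]] := pred_exists n; first by left; rewrite is_zero_M0.
by right; rewrite is_zero_MS !numKE ltr_wpDl ?numK_ge0.
Qed.

Lemma num_triangle n : (triangle_M n)%:K = n%:K * (n%:K + 1) / 2.
Proof.
suff : plus_M (triangle_M n) (triangle_M n) = times_M n (plus_M n (one_M M)).
  by move=> /num_eq; rewrite !numKE => h; lra.
induction_on n (fm1 (triangle v0 + triangle v0 == v0 * (v0 + 1))) (@env_nil M).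
  by rewrite triangle_M0 plus0 timesC times0.
rewrite triangle_MS => e; apply: numK_inj; move: e => /num_eq.
rewrite !numKE => h; lra.
Qed.

Lemma diagonal_bounds n : (triangle_M (diagonal_M n))%:K <= n%:K /\
  n%:K < (triangle_M (plus_M (diagonal_M n) (one_M M)))%:K.
Proof.
suff : ~ less n (triangle_M (diagonal_M n)) /\
    less n (triangle_M (plus_M (diagonal_M n) (one_M M))).
  by rewrite !lessE => -[/negP]; rewrite -leNgt.
induction_on n (fm1 (~ (v0 < triangle (diagonal v0)) /\ v0 < triangle (diagonal v0 + 1)))
  (@env_nil M).
  rewrite diagonal_M0 triangle_M0 zero_plus; split; first exact: less_irrefl.
  by rewrite lessE num_triangle !numKE; lra.
rewrite diagonal_MS !lessE => -[h k].
set d := diagonal_M n in h k *.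
set q := triangle_M _ in k *.
have {}h : (triangle_M d)%:K <= n%:K by rewrite leNgt; apply/negP.
have {}k := num_succ_le k.
(* If the diagonal advances, the new upper bound is the next triangular number, which exceeds [q] by
   [d + 2]; it advances only if [n + 1] has reached [q]. *)
have q2 : (triangle_M (plus_M (plus_M d (one_M M)) (one_M M)))%:K = q%:K + d%:K + 2.
  by rewrite triangle_MS !numKE; lra.
have d0 := numK_ge0 d.
have [[/num_eq e ->]|[e ->]] := is_zero_cases (monus_M q (plus_M n (one_M M)));
  move: e; rewrite num_monus !numKE => e.
  split; last by rewrite q2; move: k; lra.
  by apply/negP; rewrite -leNgt; move: e; case: ifP => //; move: k; lra.
rewrite plus0; split; first by apply/negP; rewrite -leNgt; lra.
by move: e; case: ifP; rewrite ?ltxx // -/q => _; lra.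
Qed.

(** Triangular numbers increase, so [n] lies between only one consecutive pair; two different
    diagonals would differ by at least one, and this bound is what [nra] receives. *)
Lemma diagonal_unique n s : (triangle_M s)%:K <= n%:K ->
  n%:K < (triangle_M (plus_M s (one_M M)))%:K -> diagonal_M n = s.
Proof.
have [] := diagonal_bounds n; set d := diagonal_M n; clearbody d.
rewrite !num_triangle !numKE => h1 h2 h3 h4.
have d0 := numK_ge0 d; have s0 := numK_ge0 s.
apply: numK_inj; apply/eqP; rewrite eq_le !leNgt; apply/andP; split; apply/negP.
  by move=> /num_succ_le k; nra.
by move=> /num_succ_le k; nra.
Qed.

Definition pair_M m n : N := plus_M (triangle_M (plus_M m n)) m.
Definition fst_M n : N := monus_M n (triangle_M (diagonal_M n)).
Definition snd_M n : N := monus_M (diagonal_M n) (fst_M n).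

Lemma diagonal_pair m n : diagonal_M (pair_M m n) = plus_M m n.
Proof.
have m0 := numK_ge0 m; have n0 := numK_ge0 n.
by apply: diagonal_unique; rewrite ?triangle_MS !numKE; lra.
Qed.

Lemma fst_pair m n : fst_M (pair_M m n) = m.
Proof.
have m0 := numK_ge0 m; apply: numK_inj.
by rewrite /fst_M diagonal_pair num_monus !numKE; case: ifP; lra.
Qed.

Lemma snd_pair m n : snd_M (pair_M m n) = n.
Proof.
have n0 := numK_ge0 n; apply: numK_inj.
by rewrite /snd_M fst_pair diagonal_pair num_monus !numKE; case: ifP; lra.
Qed.

Lemma pow2_gt n : n%:K < (pow2_M n)%:K.
Proof.
apply/lessE; induction_on n (fm1 (v0 < pow2 v0)) (@env_nil M).
  by rewrite pow2_M0 lessE !numKE.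
by rewrite pow2_MS !lessE => /num_succ_le; rewrite !numKE; have := numK_ge0 n; lra.
Qed.

Lemma pow2_gt0 n : 0 < (pow2_M n)%:K.
Proof. exact: le_lt_trans (numK_ge0 n) (pow2_gt n). Qed.

Lemma pow2_le m n : m%:K <= n%:K -> (pow2_M m)%:K <= (pow2_M n)%:K.
Proof.
move=> /num_leP [i <-].
rewrite -num_le_or_eq.
induction_on i (fm2 (pow2 v1 <= pow2 (v1 + v0))) (m :> @env_nil M).
  by rewrite plus0; right.
rewrite -plusA pow2_MS !num_le_or_eq => h; rewrite numKD.
by have := pow2_gt0 (plus_M m i); lra.
Qed.

Lemma eval_pairN G (rho : env M G) (u v : tm G 0) :
  ev rho (pairN u v) = pair_M (ev rho u) (ev rho v).
Proof. by rewrite /pairN eval_fun2 eval_plus eval_triangle eval_plus. Qed.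
Lemma eval_fstN G (rho : env M G) (u : tm G 0) :
  ev rho (fstN u) = fst_M (ev rho u).
Proof. by rewrite /fstN eval_fun1 eval_monus eval_triangle eval_diagonal. Qed.
Lemma eval_sndN G (rho : env M G) (u : tm G 0) :
  ev rho (sndN u) = snd_M (ev rho u).
Proof. by rewrite /sndN eval_fun1 eval_monus eval_fstN eval_diagonal. Qed.

(** * Coded rationals and their values in the field *)

Definition rat_M m n i : N := pair_M m (pair_M n i).
Definition pos_M n : N := fst_M n.
Definition neg_M n : N := fst_M (snd_M n).
Definition den_M n : N := plus_M (snd_M (snd_M n)) (one_M M).
Definition qval n : K := ((pos_M n)%:K - (neg_M n)%:K) / (den_M n)%:K.
Definition add_M m n : N := ev (n :> m :> enil) (add_Q v1 v0).
Definition opp_M n : N := ev (n :> enil) (opp_Q v0).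
Definition abs_M n : N := ev (n :> enil) (abs_Q v0).

Lemma eval_rat G (rho : env M G) (u v w : tm G 0) :
  ev rho (rat u v w) = rat_M (ev rho u) (ev rho v) (ev rho w).
Proof. by rewrite /rat !eval_pairN. Qed.
Lemma eval_pos G (rho : env M G) (u : tm G 0) :
  ev rho (pos u) = pos_M (ev rho u).
Proof. exact: eval_fstN. Qed.
Lemma eval_neg G (rho : env M G) (u : tm G 0) :
  ev rho (neg u) = neg_M (ev rho u).
Proof. by rewrite /neg eval_fstN eval_sndN. Qed.
Lemma eval_den G (rho : env M G) (u : tm G 0) :
  ev rho (den u) = den_M (ev rho u).
Proof. by rewrite /den eval_plus !eval_sndN. Qed.
Lemma eval_add_Q G (rho : env M G) (u v : tm G 0) :
  ev rho (add_Q u v) = add_M (ev rho u) (ev rho v).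
Proof. by rewrite /add_M /add_Q !eval_fun2. Qed.
Lemma eval_opp_Q G (rho : env M G) (u : tm G 0) :
  ev rho (opp_Q u) = opp_M (ev rho u).
Proof. by rewrite /opp_M /opp_Q !eval_fun1. Qed.
Lemma eval_abs_Q G (rho : env M G) (u : tm G 0) :
  ev rho (abs_Q u) = abs_M (ev rho u).
Proof. by rewrite /abs_M /abs_Q !eval_fun1. Qed.
Definition evalE := (eval_plus, eval_times, eval_predN, eval_monus, eval_pow2, eval_pairN,
  eval_fstN, eval_sndN, eval_rat, eval_pos, eval_neg, eval_den).

Lemma den_gt0 n : 0 < (den_M n)%:K.
Proof. by rewrite !numKE ltr_wpDl ?numK_ge0. Qed.

Lemma qval_rat m n i : qval (rat_M m n i) = (m%:K - n%:K) / (i%:K + 1).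
Proof. by rewrite /qval /pos_M /neg_M /den_M /rat_M fst_pair !snd_pair fst_pair !numKE. Qed.

Lemma num_pred_pos n : 0 < n%:K -> (pred_M n)%:K + 1 = n%:K.
Proof. by move=> h; rewrite num_predM h subrK. Qed.

(* Unification would otherwise unfold these functions to closed terms of L_omega. *)
#[local] Opaque diagonal_M triangle_M monus_M is_zero_M pred_M pair_M fst_M snd_M.
#[local] Opaque pos_M neg_M den_M pow2_M plus_M times_M num_of.

Lemma qval_add m n : qval (add_M m n) = qval m + qval n.
Proof.
rewrite /add_M /add_Q eval_fun2 !evalE qval_rat num_pred_pos; last first.
  by rewrite numKM mulr_gt0 ?den_gt0.
rewrite !numKD !numKM /qval.
by rewrite add_fractions ?gt_eqF ?den_gt0.
Qed.

Lemma qval_opp n : qval (opp_M n) = - qval n.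
Proof.
rewrite /opp_M /opp_Q eval_fun1 !evalE qval_rat num_pred_pos ?den_gt0 //.
by rewrite /qval -mulNr opprB.
Qed.

Lemma qval_abs n : qval (abs_M n) = `|qval n|.
Proof.
rewrite /abs_M /abs_Q eval_fun1 !evalE qval_rat num_pred_pos ?den_gt0 //.
rewrite /qval normrM normfV (gtr0_norm (den_gt0 n)) numK0 subr0 numKD 2!num_monus.
congr (_ / _); case: ifP => h; case: ifP => k; rewrite ?add0r ?addr0.
- by rewrite (_ : _ - _ = 0) ?normr0 //; apply/eqP; rewrite subr_eq0 eq_le h k.
- by rewrite ler0_norm ?opprB // subr_le0.
- by rewrite ger0_norm // subr_ge0.
- by move: h k; rewrite (leNgt (pos_M n)%:K) (leNgt (neg_M n)%:K); lra.
Qed.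

Lemma qval_lt m n : qval m < qval n <->
  (pos_M m)%:K * (den_M n)%:K + (neg_M n)%:K * (den_M m)%:K
  < (pos_M n)%:K * (den_M m)%:K + (neg_M m)%:K * (den_M n)%:K.
Proof.
rewrite /qval ltr_pdivrMr ?den_gt0 // mulrAC ltr_pdivlMr ?den_gt0 //.
by rewrite -subr_gt0 -[X in _ <-> is_true X]subr_gt0; split; congr (0 < _); ring.
Qed.

Lemma sat_lt_Q G (rho : env M G) u v :
  st (lt_Q u v) rho <-> qval (ev rho u) < qval (ev rho v).
Proof. by rewrite qval_lt -!numKM -!numKD -lessE /lt_Q; cbn [sat]; rewrite !evalE. Qed.

Lemma sat_le_Q G (rho : env M G) u v :
  st (le_Q u v) rho <-> qval (ev rho u) <= qval (ev rho v).
Proof.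
have -> : st (le_Q u v) rho <-> ~ st (lt_Q v u) rho.
  rewrite /le_Q /lt_Q; cbn [sat]; rewrite num_le_or_eq lessE !evalE.
  by rewrite leNgt; split => /negP.
by rewrite sat_lt_Q leNgt; split => /negP.
Qed.
Definition eps n : K := (pow2_M n)%:K^-1.

Lemma eps_gt0 n : 0 < eps n.
Proof. by rewrite invr_gt0 pow2_gt0. Qed.

Lemma epsS n : eps (plus_M n (one_M M)) = eps n / 2.
Proof.
by rewrite /eps pow2_MS numKD inv_double.
Qed.

Lemma eps_le m n : m%:K <= n%:K -> eps n <= eps m.
Proof. by move=> /pow2_le h; rewrite lef_pV2 // posrE pow2_gt0. Qed.

Lemma eps_lt_inv m n : eps n < eps m -> m%:K < n%:K.
Proof. by move=> h; rewrite ltNge; apply/negP => /eps_le; rewrite leNgt h. Qed.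

(** The Archimedean property relative to the model: a positive fraction has numerator at least 1 by
    discreteness, so multiplying it by its denominator suffices. *)
Lemma frac_num (a : K) : 0 < a -> exists n, 1 <= a * n%:K.
Proof.
have [[p n d] ->] := fr_surj a.
have -> : fr (Tri p n d : triple (model_arith M)) = (p%:K - n%:K) / (d%:K + 1).
  exact: fr_div.
move=> h; exists (plus_M d (one_M M)).
have d0 : 0 < d%:K + 1 by rewrite ltr_wpDl ?numK_ge0.
rewrite !numKE divfK ?gt_eqF //.
have : n%:K < p%:K by rewrite -subr_gt0 -(pmulr_lgt0 _ (_ : 0 < (d%:K + 1)^-1)) ?invr_gt0.
by move=> /num_succ_le; lra.
Qed.

(** The index [n + i] works because [2^(n + i)] exceeds [n + i], hence [i], which is at least
    [1 / a]. *)
Lemma eps_small (a : K) n : 0 < a -> exists m, n%:K <= m%:K /\ eps m < a.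
Proof.
move=> a0; have [i hi] := frac_num a0; exists (plus_M n i); rewrite numKD.
have [n0 i0] := (numK_ge0 n, numK_ge0 i); split; first by lra.
rewrite /eps invf_plt ?posrE ?pow2_gt0 //.
apply: (@le_lt_trans _ _ i%:K); last first.
  by apply: le_lt_trans (pow2_gt _); rewrite numKD; lra.
by rewrite -div1r ler_pdivrMr // mulrC.
Qed.

Lemma qval_eps G (rho : env M G) (u : tm G 0) : qval (ev rho (eps_Q u)) = eps (ev rho u).
Proof.
rewrite /eps_Q !evalE qval_rat num_pred_pos ?pow2_gt0 // numK0 subr0.
by rewrite -[(ev rho 1)%:K]/((one_M M)%:K) numK1 div1r.
Qed.

Lemma qval_eps2 G (rho : env M G) (u : tm G 0) :
  qval (ev rho (eps2_Q u)) = 2 * eps (ev rho u).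
Proof.
rewrite /eps2_Q !evalE qval_rat num_pred_pos ?pow2_gt0 // numK0 subr0 numKD.
by rewrite -[(ev rho 1)%:K]/((one_M M)%:K) numK1.
Qed.

(** * Coded reals *)

Notation R := (dom M (Nat ~> Nat)).
Implicit Types a b : R.

Definition at_ a n : K := qval (app a n).
Definition real a := forall n i, `|at_ a n - at_ a (plus_M n i)| < eps n.
Definition le_r a b := forall n, at_ a n <= at_ b n + 2 * eps n.

Lemma sat_is_real G (rho : env M G) (u : tm G 1) : st (is_real u) rho <-> real (ev rho u).
Proof.
rewrite /is_real; cbn [sat]; split=> h n i; have := h n i;
  by rewrite sat_lt_Q /sub_Q eval_abs_Q eval_add_Q eval_opp_Q qval_abs qval_add qval_opp
    qval_eps; cbn [eval]; rewrite !eval_wk.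
Qed.

Lemma sat_le_R G (rho : env M G) (u v : tm G 1) :
  st (le_R u v) rho <-> le_r (ev rho u) (ev rho v).
Proof.
rewrite /le_R; cbn [sat]; split=> h n; have := h n;
  by rewrite sat_le_Q eval_add_Q qval_add qval_eps2; cbn [eval]; rewrite !eval_wk.
Qed.

Definition lt_r a b := exists n, at_ a n + 2 * eps n < at_ b n.

Lemma sat_lt_R G (rho : env M G) (u v : tm G 1) :
  st (lt_R u v) rho <-> lt_r (ev rho u) (ev rho v).
Proof.
rewrite /lt_R; cbn [sat]; rewrite sat_le_R; split.
  move=> /not_all_ex_not [n h]; exists n; rewrite ltNge; exact/negP.
by move=> [n h] k; have := k n; rewrite leNgt h.
Qed.

Definition dist_r a b : R := ev (b :> a :> enil) (dist_R v1 v0).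

Lemma eval_dist_R G (rho : env M G) (u v : tm G 1) :
  ev rho (dist_R u v) = dist_r (ev rho u) (ev rho v).
Proof.
apply: (@model_ext M) => n; rewrite /dist_r /dist_R !eval_lam /sub_Q.
by rewrite !eval_abs_Q !eval_add_Q !eval_opp_Q; cbn [eval]; rewrite !eval_wk.
Qed.

Lemma at_dist a b n : at_ (dist_r a b) n =
  `|at_ a (plus_M n (one_M M)) - at_ b (plus_M n (one_M M))|.
Proof.
by rewrite /at_ /dist_r /dist_R eval_lam /sub_Q eval_abs_Q eval_add_Q eval_opp_Q
  qval_abs qval_add qval_opp.
Qed.

Definition const n : R := ev (n :> enil) (lam v1).

Lemma at_const m n : at_ (const m) n = qval m.
Proof. by rewrite /at_ eval_lam. Qed.

Lemma real_const m : real (const m).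
Proof. by move=> n i; rewrite !at_const subrr normr0 eps_gt0. Qed.

Lemma at_zero G (rho : env M G) n : at_ (ev rho zero_R) n = 0.
Proof.
by rewrite /at_ /zero_R eval_lam eval_rat qval_rat -[ev _ 0]/(zero_M M) subrr mul0r.
Qed.

Lemma at_one G (rho : env M G) n : at_ (ev rho one_R) n = 1.
Proof.
rewrite /at_ /one_R eval_lam eval_rat qval_rat -[ev _ 0]/(zero_M M) -[ev _ 1]/(one_M M).
by rewrite !numKE subr0 add0r divr1.
Qed.

Lemma real_close a m n : real a -> m%:K <= n%:K -> `|at_ a m - at_ a n| < eps m.
Proof. by move=> ra /num_leP [i <-]; apply: ra. Qed.

Lemma max_num m n : exists i, m%:K <= i%:K /\ n%:K <= i%:K.
Proof.
by exists (plus_M m n); rewrite numKD; have := numK_ge0 m; have := numK_ge0 n; lra.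
Qed.

(** The slack [2 * eps m] of [le_r] is exactly what the two rates of convergence cost in passing
    from index [m] to a late index. *)
Lemma le_r_eventually a b n0 : real a -> real b ->
  (forall n, n0%:K <= n%:K -> at_ a n <= at_ b n) -> le_r a b.
Proof.
move=> ra rb h m; have [n [hm h0]] := max_num m n0.
have := h n h0; have := real_close ra hm; have := real_close rb hm.
by rewrite !ltr_norml => /andP[A1 A2] /andP[B1 B2]; lra.
Qed.

Definition pos_r a := exists (c : K) n0, 0 < c /\
  forall n, n0%:K <= n%:K -> c < at_ a n.

Lemma pos_realP a (z : R) : real a -> (forall n, at_ z n = 0) -> lt_r z a -> pos_r a.
Proof.
move=> ra z0 [m]; rewrite z0 => h; exists (at_ a m - eps m), m; split.
  by have := eps_gt0 m; lra.
by move=> n /(real_close ra); rewrite ltr_norml => /andP[A1 A2]; lra.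
Qed.

Lemma dist_lt a b (e : R) (c d : K) m0 n0 :
  (forall n, m0%:K <= n%:K -> c < at_ e n) -> d < c ->
  (forall n, n0%:K <= n%:K -> `|at_ a n - at_ b n| <= d + 2 * eps n) ->
  lt_r (dist_r a b) e.
Proof.
move=> he dc h; have [i [h1 h2]] := max_num m0 n0.
(* The distance is read at index [n + 1], where the error [2 * eps (n + 1)] equals [eps n]; the
   definition of [lt_r] adds [2 * eps n]. Together this is [3 * eps n], which must stay below
   [c - d]. *)
have [n [hn en]] : exists n, i%:K <= n%:K /\ eps n < (c - d) / 3.
  by apply: eps_small; lra.
exists n; rewrite at_dist.
have := he n (le_trans h1 hn); have := h (plus_M n (one_M M)).
rewrite epsS numKD numK1 => H H'; have := H _; move=> {}H.
have {}H := H ltac:(lra); lra.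
Qed.

(** The gap [2 * eps j] found at index [j] is [4 * eps s] at the shifted index [s], enough to absorb
    the drift of both reals. The second conclusion keeps a numerical witness of [b - d < a], the
    form required by [approx_fm]. *)
Lemma dist_close a b n (d : K) : real a -> real b ->
  lt_r (dist_r a b) (const n) -> qval n = d ->
  (forall i, `|at_ a i - at_ b i| < d + 2 * eps i) /\
  exists i, at_ b i + 2 * eps i < at_ a i + d.
Proof.
move=> ra rb [j]; rewrite at_dist at_const => + vn; rewrite vn.
set s := plus_M j (one_M M) => h; split; last first.
  exists s; rewrite epsS -/s; have e0 := eps_gt0 j.
  by move: h; rewrite -ltrBrDr ltr_norml => /andP[A1 A2]; lra.
have es : eps s = eps j / 2 by rewrite epsS.
have js : j%:K <= s%:K by rewrite !numKE; lra.
clearbody s; move=> i; have ei := eps_gt0 i; have ej := eps_gt0 j.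
move: h; rewrite -ltrBrDr ltr_norml => /andP[A1 A2].
have [hi|hi] := leP s%:K i%:K.
  have := real_close ra hi; have := real_close rb hi.
  by rewrite !ltr_norml => /andP[B1 B2] /andP[C1 C2]; apply/andP; lra.
have := real_close ra (ltW hi); have := real_close rb (ltW hi).
by rewrite !ltr_norml => /andP[B1 B2] /andP[C1 C2]; apply/andP; lra.
Qed.

(** * Sequences of functions *)

#[local] Transparent plus_M times_M.

Lemma choice_sat s t (ax : forall B, QFAC s t B -> st B env_nil) G (A : fm (t :: s :: G))
    (rho : env M G) : qf A = true ->
  (forall c, exists d, st A (d :> (c :> rho))) ->
  exists Y, forall c, st A (app Y c :> (c :> rho)).
Proof.
move=> qA h; have /sat_closure/(_ rho) := ax _ (QFAC_inst qA).
rewrite /choice; cbn [sat] => /(_ h) [Y k]; exists Y => c.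
have := k c; rewrite sat_subst; congr (st A _).
by apply: fam_ext => // r v; move: r v; apply: mem_case.
Qed.

Notation v5 := (Var (there (there (there (there (there here)))))).

Lemma eval_rec G (rho : env M G) u v w :
  ev rho (Cst Rec0 $ u $ v $ w)%tm = recur (ev rho u) (ev rho v) (ev rho w).
Proof. by []. Qed.

(** Case distinction on the argument, done by a recursion whose step ignores the previous value.
    Packing a number with a function lets a single application of choice deliver both. *)
Definition cons n (f : R) : R :=
  ev (f :> (n :> enil)) (lam (Cst Rec0 $ lam (lam (v3 $ v1)) $ v2 $ v0))%tm.

Lemma cons0 n f : app (cons n f) (zero_M M) = n.
Proof. by rewrite eval_lam; apply: recur_0. Qed.

Lemma consS n f m : app (cons n f) (plus_M m (one_M M)) = app f m.
Proof.
by rewrite eval_lam eval_rec; apply: etrans (recur_S _ _ _) _; rewrite !eval_lam.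
Qed.

Definition tail (f : R) : R := ev (f :> enil) (lam (v1 $ (v0 + 1)))%tm.

Lemma app_tail f n : app (tail f) n = app f (plus_M n (one_M M)).
Proof. by rewrite eval_lam. Qed.

Lemma tail_unique (f f' : R) : (forall n, app f' n = app f (plus_M n (one_M M))) -> f' = tail f.
Proof. by move=> h; apply: (@model_ext M) => n; rewrite app_tail. Qed.

Lemma tail_cons n f : tail (cons n f) = f.
Proof. by apply/esym/tail_unique => m; rewrite consS. Qed.

Lemma app_const m n : app (const m) n = m.
Proof. by rewrite eval_lam. Qed.

Definition pos_zero : R := ev enil zero_R.

Lemma pos_const m : 0 < qval m -> lt_r pos_zero (const m).
Proof.
move=> h; have [n [_ hn]] : exists n, (zero_M M)%:K <= n%:K /\ eps n < qval m / 2.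
  by apply: eps_small; lra.
by exists n; rewrite at_zero at_const; lra.
Qed.

(** * From choice to monotone subsequences *)

Section Subsequence.
Hypothesis qfac01 : forall B, QFAC 0 1 B -> st B env_nil.
Variables (F : dom M 2) (L : dom M (1 ~> 1 ~> 0)) (X : dom M (1 ~> 1)) (x : R).

Let D d := app F d = one_M M.
Let below d e := app (app L d) e = one_M M.

Hypothesis directed_D : forall d, D d -> forall e, D e ->
  exists w, D w /\ below d w /\ below e w.
Hypothesis real_X : forall d, D d -> real (app X d).
Hypothesis increasing_X : forall d, D d -> forall e, D e -> below d e ->
  le_r (app X d) (app X e).
Hypothesis real_x : real x.
Hypothesis converges_X : forall e, real e -> lt_r pos_zero e ->
  exists d, D d /\ forall w, D w -> below d w -> lt_r (dist_r (app X w) x) e.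

Lemma net_approx k : exists d0, D d0 /\ forall d, D d -> below d0 d ->
  (forall n, `|at_ (app X d) n - at_ x n| < eps k + 2 * eps n) /\
  exists n, at_ x n + 2 * eps n < at_ (app X d) n + eps k.
Proof.
pose c := ev (k :> enil) (eps_Q v0).
have qc : qval c = eps k by apply: qval_eps.
have [||d0 [D0 h]] := @converges_X (const c).
- exact: real_const.
- by apply: pos_const; rewrite qc eps_gt0.
exists d0; split=> // d Dd le; apply: (dist_close (real_X Dd) real_x (h d Dd le) qc).
Qed.

Lemma net_below_limit d : D d -> le_r (app X d) x.
Proof.
move=> Dd n; rewrite leNgt; apply/negP => lt.
set c := at_ (app X d) n - at_ x n - 2 * eps n.
have c0 : 0 < c by rewrite /c; lra.
have [k [_ hk]] := eps_small (a := c / 2) n ltac:(lra).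
have [d0 [D0 h]] := net_approx k.
have [z [Dz [dz d0z]]] := directed_D Dd D0.
have [{}h _] := h z Dz d0z.
(* Following the real at [z] to a late index [m] gives [c < eps k + 4 * eps m]; the bounds [c / 2]
   and [c / 8] make the right side smaller than [c]. *)
have [m [nm hm]] := eps_small (a := c / 8) n ltac:(lra).
have := h m; have := increasing_X Dd Dz dz m.
have := real_close (real_X Dd) nm; have := real_close real_x nm.
rewrite !ltr_norml => /andP[A1 A2] /andP[B1 B2] C1 /andP[E1 E2].
by move: c0 hk hm; rewrite /c; lra.
Qed.

Definition good_subsequence (P : dom M (0 ~> 1)) :=
  [/\ forall n, D (app P n),
      forall m n, m%:K <= n%:K -> le_r (app X (app P m)) (app X (app P n)) &
      forall e, real e -> lt_r pos_zero e -> exists n, forall m, n%:K <= m%:K ->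
        lt_r (dist_r (app X (app P m)) x) e].

Lemma subsequence_attained d : D d -> le_r x (app X d) -> exists P, good_subsequence P.
Proof.
move=> Dd le; exists (ev (d :> enil) (lam v1)).
have E n : app (ev (d :> enil) (lam v1)) n = d by rewrite eval_lam.
split=> [n|m n _|e re he]; rewrite ?E //.
  by move=> n'; have := eps_gt0 n'; lra.
have [c [m0 [c0 hc]]] := pos_realP re (at_zero enil) he.
exists m0 => m _; rewrite E; apply: (dist_lt (d := 0) hc c0 (n0 := m0)) => n _.
have := net_below_limit Dd n; have := le n.
by rewrite ler_norml => *; apply/andP; lra.
Qed.

(** That [x_d] exceeds [x - 2^-k] is existential; to keep the matrix quantifier-free, [f 0] stores
    the index at which it is visible, and the tail of [f] is [d]. *)
Definition approx_fm : fm [1; 0; 2; 1 ~> 1; 1]%ty :=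
  let d := lam (v1 $ (v0 + 1))%tm in let n := (v0 $ 0)%tm in
  (elt2 v2 d /\ lt_Q (add_Q (v4 $ n) (eps2_Q n)) (add_Q (v3 $ d $ n) (eps_Q v1)))%fm.

Lemma sat_approx (f : R) k : st approx_fm (f :> (k :> (F :> (X :> (x :> enil))))) <->
  D (tail f) /\ at_ x (app f (zero_M M)) + 2 * eps (app f (zero_M M))
    < at_ (app X (tail f)) (app f (zero_M M)) + eps k.
Proof.
rewrite /approx_fm; cbn [sat].
rewrite sat_lt_Q 2!eval_add_Q 2!qval_add qval_eps2 qval_eps; cbn [eval].
have -> : ev (f :> (k :> (F :> (X :> (x :> enil))))) (lam (v1 $ (v0 + 1)))%tm = tail f.
  by apply: tail_unique => n; rewrite eval_lam.
by [].
Qed.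

(** The same device for [x_{d_k} < x - 2^-g(k)]: [f 0] is the index of comparison and [f 1] is
    [g(k)]. *)
Definition gap_fm : fm [1; 0; 0 ~> 1; 1 ~> 1; 1]%ty :=
  let d := lam (v3 $ v2 $ (v0 + 1))%tm in let n := (v0 $ 0)%tm in
  lt_Q (add_Q (v3 $ d $ n) (add_Q (eps2_Q n) (eps_Q (v0 $ 1)))) (v4 $ n).

Lemma sat_gap (f : R) k (Y : dom M (0 ~> 1)) :
  st gap_fm (f :> (k :> (Y :> (X :> (x :> enil))))) <->
  at_ (app X (tail (app Y k))) (app f (zero_M M))
    + (2 * eps (app f (zero_M M)) + eps (app f (one_M M))) < at_ x (app f (zero_M M)).
Proof.
rewrite /gap_fm sat_lt_Q 2!eval_add_Q 2!qval_add qval_eps2 qval_eps; cbn [eval].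
have -> : ev (f :> (k :> (Y :> (X :> (x :> enil))))) (lam (v3 $ v2 $ (v0 + 1)))%tm
    = tail (app Y k) by apply: tail_unique => n; rewrite eval_lam.
by [].
Qed.

Lemma subsequence_strict : (forall d, D d -> lt_r (app X d) x) ->
  exists P, good_subsequence P.
Proof.
move=> strict.
have [Y hY] : exists Y, forall k,
    st approx_fm (app Y k :> (k :> (F :> (X :> (x :> enil))))).
  apply: (choice_sat qfac01) => // k.
  have [d [Dd h]] := net_approx k.
  (* Directedness applied to [d] and itself yields an index above [d]. *)
  have [z [Dz [dz _]]] := directed_D Dd Dd.
  have [_ [n hn]] := h z Dz dz.
  by exists (cons n z); apply/sat_approx; rewrite tail_cons cons0.
pose a k := app X (tail (app Y k)).
have DY k : D (tail (app Y k)) by have /sat_approx [] := hY k.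
have real_a k : real (a k) by apply: real_X.
(* At the stored index [m] the margin is [2 * eps m], which covers the drift of both reals beyond
   [m]; the same holds for [high]. *)
have low k : exists m, forall n, m%:K <= n%:K -> at_ x n < at_ (a k) n + eps k.
  have /sat_approx [_] := hY k; set m := app _ (zero_M M) => h; exists m => n hn.
  have := real_close (real_a k) hn; have := real_close real_x hn; move: h.
  by rewrite !ltr_norml -/(a k) => h /andP[A1 A2] /andP[B1 B2]; lra.
have [Z hZ] : exists Z : dom M (0 ~> 1), forall k,
    st gap_fm (app Z k :> (k :> (Y :> (X :> (x :> enil))))).
  apply: (choice_sat qfac01) => // k.
  have [n hn] := strict _ (DY k).
  have [j [_ hj]] := eps_small (a := at_ x n - at_ (a k) n - 2 * eps n) n ltac:(rewrite /a; lra).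
  exists (cons n (const j)); apply/sat_gap.
  rewrite cons0 -[one_M M]zero_plus consS app_const; move: hj; rewrite /a; lra.
pose g k := app (app Z k) (one_M M).
have high k : exists m, forall n, m%:K <= n%:K -> at_ (a k) n + eps (g k) < at_ x n.
  have /sat_gap := hZ k; set m := app _ (zero_M M) => h; exists m => n hn.
  have := real_close (real_a k) hn; have := real_close real_x hn; move: h.
  by rewrite !ltr_norml -/(a k) -/(g k) => h /andP[A1 A2] /andP[B1 B2]; lra.
(* From [low] and [high], [x - 2^-k < x_{d_k} < x - 2^-g(k)], which forces [g(k) > k]. *)
have g_gt k : k%:K < (g k)%:K.
  have [m hm] := low k; have [n hn] := high k; have [i [mi ni]] := max_num m n.
  by apply: eps_lt_inv; have := hm i mi; have := hn i ni; lra.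
(* The step function ignores the counter, so [Rec0] iterates [g]; only numbers are iterated, as the
   type of [Rec0] requires. *)
pose H : dom M (0 ~> 0 ~> 0) := ev (Z :> enil) (lam (lam (v2 $ v0 $ 1)))%tm.
pose h n := recur H (zero_M M) n.
have hS n : h (plus_M n (one_M M)) = g (h n) by rewrite /h recur_S !eval_lam.
have h_ge n : n%:K <= (h n)%:K.
  apply/num_le_or_eq; rewrite /h.
  induction_on n ((v0 <= Cst Rec0 $ v1 $ 0 $ v0)%fm : fm [Nat; 0 ~> 0 ~> 0]%ty)
    (H :> @env_nil M).
    by rewrite recur_0; right.
  move=> /num_le_or_eq IH; apply/num_le_or_eq; rewrite -/(h _) hS numKD numK1.
  by have := num_succ_le (g_gt (h n)); move: IH; rewrite -/(h n); lra.
have h_mono m n : m%:K <= n%:K -> (h m)%:K <= (h n)%:K.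
  move=> /num_leP [i <-]; apply/num_le_or_eq; rewrite /h.
  induction_on i ((Cst Rec0 $ v2 $ 0 $ v1 <= Cst Rec0 $ v2 $ 0 $ (v1 + v0))%fm
    : fm [Nat; Nat; 0 ~> 0 ~> 0]%ty) (m :> (H :> @env_nil M)).
    by rewrite plus0; right.
  move=> /num_le_or_eq IH; left; apply/lessE; rewrite -plusA -/(h _) -/(h (plus_M _ _)) hS.
  by apply: le_lt_trans (g_gt _); exact: IH.
pose P : dom M (0 ~> 1) := ev (Y :> (H :> enil))
  (lam (lam (v2 $ (Cst Rec0 $ v3 $ 0 $ v1) $ (v0 + 1))))%tm.
have PE n : app P n = tail (app Y (h n)).
  by apply: tail_unique => m; rewrite !eval_lam.
exists P; split=> [n|m n|e re he].
- by rewrite PE; apply: DY.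
- rewrite le_eqVlt => /orP [/eqP /numK_inj ->|/num_succ_le mn].
    by move=> i; have := eps_gt0 i; lra.
  (* The term at [m] lies below [x - 2^-g(h m)] and the term at [n] above [x - 2^-(h n)]; for
     [m < n] the exponent [h n] is at least [h (m + 1) = g (h m)]. *)
  rewrite !PE; have [m1 h1] := high (h m); have [m2 h2] := low (h n).
  have [i [i1 i2]] := max_num m1 m2.
  apply: (le_r_eventually (real_a _) (real_a _) (n0 := i)) => j hj.
  have := h1 j (le_trans i1 hj); have := h2 j (le_trans i2 hj).
  have : eps (h n) <= eps (g (h m)).
    by apply: eps_le; rewrite -hS; apply: h_mono; rewrite numKD numK1.
  lra.
- have [c [m0 [c0 hc]]] := pos_realP re (at_zero enil) he.
  have [n [_ hn]] := eps_small m0 c0.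
  exists n => m hm; rewrite PE.
  have [m1 h1] := high (h m); have [m2 h2] := low (h m).
  have [i [i1 i2]] := max_num m1 m2.
  apply: (dist_lt (d := eps (h m)) hc _ (n0 := i)).
    apply: le_lt_trans hn; apply: eps_le; exact: le_trans hm (h_ge m).
  move=> j hj; have := h1 j (le_trans i1 hj); have := h2 j (le_trans i2 hj).
  have := eps_gt0 j; have := eps_gt0 (g (h m)).
  by rewrite -/(a _) ler_norml => *; apply/andP; lra.
Qed.

Lemma subsequence : exists P, good_subsequence P.
Proof.
have [[d [Dd le]]|no] := classic (exists d, D d /\ le_r x (app X d)).
  exact: subsequence_attained Dd le.
apply: subsequence_strict => d Dd.
have : ~ le_r x (app X d) by move=> le; apply: no; exists d.
by move=> /not_all_ex_not [n hn]; exists n; rewrite ltNge; apply/negP.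
Qed.
End Subsequence.

Lemma pos_realE G (rho : env M G) (u : tm G 1) :
  st (lt_R zero_R u) rho <-> lt_r pos_zero (ev rho u).
Proof.
by rewrite sat_lt_R; split=> -[n h]; exists n; move: h; rewrite !at_zero.
Qed.

Theorem QFAC01_SUB0 : (forall B, QFAC 0 1 B -> st B env_nil) -> st SUB0 env_nil.
Proof.
move=> qfac01; rewrite /SUB0; cbn [sat].
move=> F L X x _ _ dir unit incr [rx _] conv.
pose rho := x :> (X :> (L :> (F :> enil))).
have [|||||P [P1 P2 P3]] := @subsequence qfac01 F L X x.
- have [_ [_ [_ h]]] := dir; exact: h.
- move=> d Dd.
  have h : st (is_real (v2 $ v0)%tm) (d :> rho) := proj1 (unit d Dd).
  by move: h; rewrite sat_is_real.
- move=> d Dd e De de.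
  have h : st (le_R (v3 $ v1)%tm (v3 $ v0)%tm) (e :> (d :> rho)) := incr d Dd e De de.
  by move: h; rewrite sat_le_R.
- have h : st (is_real v0) rho := rx.
  by move: h; rewrite sat_is_real.
- move=> e re he.
  have re' : st (is_real v0) (e :> rho) by rewrite sat_is_real.
  have he' : st (lt_R zero_R v0) (e :> rho) by rewrite pos_realE.
  have [d [Dd h]] := conv e re' he'; exists d; split; first exact: Dd.
  move=> w Dw dw.
  have {}h : st (lt_R (dist_R (v4 $ v0)%tm v3) v2) (w :> (d :> (e :> rho))) := h w Dw dw.
  by move: h; rewrite sat_lt_R eval_dist_R.
exists P; split; first exact: P1.
have appu G (tau : env M G) n u v : app (ev tau (lam (wk u $ (wk v $ v0)))%tm) n
    = app (ev tau u) (app (ev tau v) n) by rewrite eval_lam; cbn [eval]; rewrite !eval_wk.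
split.
- rewrite /seq_increasing; cbn [sat] => m n mn.
  rewrite sat_le_R; cbn [eval]; rewrite !eval_wk !appu.
  apply: P2; apply/num_le_or_eq; exact: mn.
- rewrite /seq_converges /AllPosReal; cbn [sat] => e; rewrite sat_is_real pos_realE => re he.
  have [n h] := P3 e re he; exists n => m mn.
  rewrite sat_lt_R eval_dist_R; cbn [eval]; rewrite !eval_wk appu.
  apply: h; apply/num_le_or_eq; exact: mn.
Qed.

(** * From monotone subsequences to choice *)

Section Choice.
Hypothesis sub0 : st SUB0 env_nil.

Lemma le_1_cases n : n = zero_M M \/ n = one_M M -> less n (one_M M) \/ n = one_M M.
Proof. by move=> [->|->]; [left; apply: less_0_1|right]. Qed.

Lemma qfac10 A : QFAC 1 0 A -> st A env_nil.
Proof. by move=> h; apply: (base M); apply: RCA_QFAC. Qed.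

(** For a function with values 0 and 1 this product is the characteristic function of a bounded
    universal quantifier. *)
Definition prod_M (a : R) n : N :=
  recur (ev (a :> enil) (lam (lam (v0 * (v2 $ v1))))%tm) (one_M M) n.

Lemma prod_MS a n : prod_M a (plus_M n (one_M M)) = times_M (prod_M a n) (app a n).
Proof. by rewrite /prod_M recur_S !eval_lam. Qed.

Lemma prod_M_cases a : (forall i, app a i = zero_M M \/ app a i = one_M M) -> forall n,
  (prod_M a n = one_M M /\ forall i, less i n -> app a i = one_M M) \/
  (prod_M a n = zero_M M /\ exists i, less i n /\ app a i = zero_M M).
Proof.
move=> ha n; rewrite /prod_M.
induction_on n (let p := (Cst Rec0 $ lam (lam (v0 * (v3 $ v1))) $ 1 $ v0)%tm in
    ((p == 1 /\ All 0 (v0 < v1 =>> v2 $ v0 == 1))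
     \/ (p == 0 /\ Ex 0 (v0 < v1 /\ v2 $ v0 == 0)))%fm : fm [Nat; 1]%ty) (a :> @env_nil M).
  left; rewrite recur_0; split=> // i /lessE; rewrite numK0 ltNge numK_ge0 //.
rewrite -!/(prod_M a _) prod_MS => -[[-> h]|[-> [i [h e]]]]; last first.
  right; rewrite timesC times0; split=> //; exists i; split=> //.
  by apply: less_trans h (less_succ n).
rewrite timesC times1; case: (ha n) => e; rewrite e; [right|left]; split=> //.
  by exists n; split=> //; apply: less_succ.
move=> i /lessE /num_succ_le; rewrite numKD numK1 => k.
have : i%:K <= n%:K by lra.
by move=> /num_le_or_eq [/h|->].
Qed.

(** The entry comes with its own index in front, because [decide_B] tests an index and a function
    packed into one argument. Position 0 of [d] holds the length, hence the successor in the
    code. *)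
Definition slice (d : R) n : R := ev (d :> (n :> enil))
  (lam (Cst Rec0 $ lam (lam (v3 $ (pairN v4 v1 + 1))) $ v2 $ v0))%tm.

Lemma slice0 d n : app (slice d n) (zero_M M) = n.
Proof. by rewrite eval_lam; apply: recur_0. Qed.

Lemma sliceS d n m :
  app (slice d n) (plus_M m (one_M M)) = app d (plus_M (pair_M n m) (one_M M)).
Proof.
rewrite eval_lam eval_rec; apply: etrans (recur_S _ _ _) _; rewrite !eval_lam.
by cbn [eval]; rewrite eval_pairN.
Qed.

Lemma cons_unique (d e : R) : app d (zero_M M) = app e (zero_M M) ->
  (forall m, app d (plus_M m (one_M M)) = app e (plus_M m (one_M M))) -> d = e.
Proof.
by move=> h k; apply: (@model_ext M) => m; have [->|[n ->]] := pred_exists m.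
Qed.

Lemma slice_unique (d e : R) n : app e (zero_M M) = n ->
  (forall m, app e (plus_M m (one_M M)) = app d (plus_M (pair_M n m) (one_M M))) ->
  e = slice d n.
Proof.
by move=> h k; apply: cons_unique => [|m]; [rewrite slice0|rewrite sliceS].
Qed.

(** The two [is_zero] factors are the characteristic functions of [fst < k] and [k <= fst]: old
    entries are copied, and [f] fills position [k] and everything after it. *)
Definition snoc (d f : R) k : R := ev (d :> (f :> (k :> enil)))
  (lam (Cst Rec0 $ lam (lam
     (is_zero (monus (fstN v1 + 1) v5) * (v3 $ (v1 + 1))
      + is_zero (monus v5 (fstN v1)) * (v4 $ sndN v1))) $ (v3 + 1) $ v0))%tm.

Lemma snoc0 d f k : app (snoc d f k) (zero_M M) = plus_M k (one_M M).
Proof. by rewrite eval_lam; apply: recur_0. Qed.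

Lemma snocS d f k m : app (snoc d f k) (plus_M m (one_M M)) =
  plus_M
    (times_M (is_zero_M (monus_M (plus_M (fst_M m) (one_M M)) k)) (app d (plus_M m (one_M M))))
    (times_M (is_zero_M (monus_M k (fst_M m))) (app f (snd_M m))).
Proof.
rewrite eval_lam eval_rec; apply: etrans (recur_S _ _ _) _; rewrite !eval_lam.
by rewrite eval_plus !eval_times !eval_is_zero !eval_monus; cbn [eval];
  rewrite eval_fstN eval_sndN.
Qed.

Lemma is_zero_monus m n : is_zero_M (monus_M m n) = one_M M <-> m%:K <= n%:K.
Proof.
have [[/num_eq e ->]|[e ->]] := is_zero_cases (monus_M m n);
  move: e; rewrite num_monus ?numK0; case: (leP m%:K n%:K) => h e.
- by split.
- by exfalso; lra.
- by move: e; rewrite ltxx.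
- by split=> // /esym /one_neq_zero.
Qed.

Lemma is_zero_monus0 m n : n%:K < m%:K -> is_zero_M (monus_M m n) = zero_M M.
Proof.
move=> h; have [[e k]|[_ //]] := is_zero_cases (monus_M m n).
by move/is_zero_monus: k; rewrite leNgt h.
Qed.

Lemma slice_snoc d f k i : i%:K < k%:K -> slice (snoc d f k) i = slice d i.
Proof.
move=> h; apply: cons_unique => [|m]; first exact: etrans (slice0 _ _) (esym (slice0 _ _)).
apply: etrans (sliceS _ _ _) _; apply: etrans _ (esym (sliceS _ _ _)).
rewrite snocS fst_pair.
have -> : is_zero_M (monus_M (plus_M i (one_M M)) k) = one_M M.
  by apply/is_zero_monus; rewrite numKD numK1 num_succ_le.
by rewrite is_zero_monus0 // timesC times1 timesC times0 plus0.
Qed.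

Lemma slice_snoc_last d f k : slice (snoc d f k) k = cons k f.
Proof.
apply: cons_unique => [|m]; first by rewrite slice0 cons0.
rewrite sliceS consS snocS fst_pair snd_pair.
have -> : is_zero_M (monus_M k k) = one_M M by apply/is_zero_monus.
rewrite is_zero_monus0; last by rewrite numKD numK1 ltrDl.
by rewrite timesC times0 timesC times1 zero_plus.
Qed.

(* [d] codes a sequence of [d 0] functions, the [i]-th one being [tail (slice d i)]. *)
Section Instance.
Variables (G : ctx) (B : fm (1%ty :: (0%ty :: G))) (rho : env M G).
Hypothesis qf_B : qf B = true.
Hypothesis exists_B : forall n, exists f, st B (f :> (n :> rho)).

(** Choice of a truth value: [QFAC 1 0] is applied to the disjunction of [B'] with value 1 and its
    negation with value 0. [B'] reads its number from position 0 of [d] and its function from the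
    tail. *)
Lemma decide_B : exists C : dom M 2, forall d,
  (st B (tail d :> (app d (zero_M M) :> rho)) <-> app C d = one_M M) /\
  (app C d = zero_M M \/ app C d = one_M M).
Proof.
pose B' : fm (0%ty :: (1%ty :: G)) := subst B
  (scons (P := tm (0%ty :: (1%ty :: G))) (lam (v2 $ (v0 + 1)))%tm
    (scons (P := tm (0%ty :: (1%ty :: G))) (v1 $ 0)%tm
      (fun r v => Var (there (there v))))).
have BE (d : R) n : st B' (n :> (d :> rho)) <-> st B (tail d :> (app d (zero_M M) :> rho)).
  rewrite sat_subst; suff -> : (fun r (v : mem (1%ty :: (0%ty :: G)) r) => ev (n :> (d :> rho))
    (scons (P := tm (0%ty :: (1%ty :: G))) (lam (v2 $ (v0 + 1)))%tm
    (scons (P := tm (0%ty :: (1%ty :: G))) (v1 $ 0)%tm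
      (fun r v => Var (there (there v)))) v)) = (tail d :> (app d (zero_M M) :> rho)) by [].
  apply: fam_ext; first by apply: tail_unique => m; rewrite eval_lam.
  by move=> r v; move: r v; apply: mem_case.
have [||C hC] := choice_sat qfac10 (rho := rho)
  (A := ((B' /\ v0 == 1) \/ (~ B' /\ v0 == 0))%fm).
- by rewrite /= !qf_subst qf_B.
- move=> d; have [h|h] := classic (st B (tail d :> (app d (zero_M M) :> rho))).
    by exists (one_M M); left; split=> //; apply/BE.
  by exists (zero_M M); right; split=> // /BE.
exists C => d; have := hC d; cbn [sat]; rewrite !BE => -[[h e]|[h e]]; split; auto.
- by split.
- by split=> // k; case: (one_neq_zero (M := M)); exact: etrans (esym k) e.
Qed.

Lemma choice_01_instance : exists Y : dom M (0 ~> 1), forall n, st B (app Y n :> (n :> rho)).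
Proof.
have [C hC] := decide_B.
pose T d : R := ev (d :> (C :> enil)) (lam (v2 $
  lam (Cst Rec0 $ lam (lam (v4 $ (pairN v3 v1 + 1))) $ v1 $ v0)))%tm.
have TE d i : app (T d) i = app C (slice d i).
  rewrite eval_lam; cbn [eval]; apply: (f_equal (app C)).
  apply: slice_unique => [|m]; first by rewrite eval_lam; apply: recur_0.
  rewrite eval_lam eval_rec; apply: etrans (recur_S _ _ _) _.
  by rewrite !eval_lam; cbn [eval]; rewrite eval_pairN.
have T01 d i : app (T d) i = zero_M M \/ app (T d) i = one_M M.
  by rewrite TE; have [] := hC (slice d i).
(* Membership asks that all entries below the length pass the test, as a product of the values of
   [T]; the inner [lam] is [slice] spelled out as a term. *)
pose F : dom M 2 := ev (C :> enil) (lam (Cst Rec0 $ lam (lam (v0 * (v3 $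
  lam (Cst Rec0 $ lam (lam (v5 $ (pairN v4 v1 + 1))) $ v2 $ v0)))) $ 1 $ (v0 $ 0)))%tm.
have FE d : app F d = prod_M (T d) (app d (zero_M M)).
  rewrite eval_lam eval_rec /prod_M.
  apply: (f_equal (fun f => recur f (one_M M) (app d (zero_M M)))).
  apply: (@model_ext M) => i; apply: (@model_ext M) => j; rewrite 4!eval_lam.
  cbn [eval]; apply: etrans (f_equal (times_M j) (esym (TE d i))).
  apply: (f_equal (fun e => times_M j (app C e))).
  apply: slice_unique => [|m]; first by rewrite eval_lam; apply: recur_0.
  rewrite eval_lam eval_rec; apply: etrans (recur_S _ _ _) _.
  by rewrite !eval_lam; cbn [eval]; rewrite eval_pairN.
pose good d := forall i, i%:K < (app d (zero_M M))%:K ->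
  st B (tail (slice d i) :> (i :> rho)).
have F1 d : app F d = one_M M <-> good d.
  rewrite FE; split=> [e i hi|h].
    have [[_ h]|[e' _]] := prod_M_cases (T01 d) (app d (zero_M M)).
      have := h i; rewrite lessE TE => /(_ hi).
      by have [<- _] := hC (slice d i); rewrite slice0.
    by case: (one_neq_zero (M := M)); exact: etrans (esym e) e'.
  have [[//]|[_ [i [/lessE /h k e]]]] := prod_M_cases (T01 d) (app d (zero_M M)).
  move: e; rewrite TE; have [[e' _] _] := hC (slice d i).
  rewrite e'; first by move=> /one_neq_zero.
  by rewrite slice0.
have F01 d : app F d = zero_M M \/ app F d = one_M M.
  by rewrite FE; have [[-> _]|[-> _]] := prod_M_cases (T01 d) (app d (zero_M M)); auto.
pose L : dom M (1 ~> 1 ~> 0) := ev enil (lam (lam (is_zero (monus (v1 $ 0) (v0 $ 0)))))%tm.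
have LE d e : app (app L d) e = is_zero_M (monus_M (app d (zero_M M)) (app e (zero_M M))).
  by rewrite !eval_lam eval_is_zero eval_monus.
have L1 d e : app (app L d) e = one_M M <-> (app d (zero_M M))%:K <= (app e (zero_M M))%:K.
  by rewrite LE is_zero_monus.
(* The constant real [k / (k + 1)] with [k] the length, since [rat] stores its denominator minus
   one. *)
pose X : dom M (1 ~> 1) := ev enil (lam (lam (rat (v1 $ 0) 0 (v1 $ 0))))%tm.
pose len d : K := (app d (zero_M M))%:K.
have len0 d : 0 <= len d by apply: numK_ge0.
have XE d n : at_ (app X d) n = len d / (len d + 1).
  by rewrite /at_ !eval_lam eval_rat qval_rat -[ev _ 0]/(zero_M M) numK0 subr0.
have real_X d : real (app X d) by move=> n i; rewrite !XE subrr normr0 eps_gt0.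
pose x : R := ev enil one_R.
have xE n : at_ x n = 1 by apply: at_one.
have real_x : real x by move=> n i; rewrite !xE subrr normr0 eps_gt0.
have dist d n : `|at_ (app X d) n - at_ x n| = (len d + 1)^-1.
  by rewrite XE xE; apply: one_minus_fraction.
(* The induction formula quantifies over functions: no choice of extensions is available yet, so
   each step asserts only that some longer sequence exists. *)
have long k : exists d, app F d = one_M M /\ app d (zero_M M) = k.
  induction_on k ((Ex 1 (v2 $ v0 == 1 /\ v0 $ 0 == v1))%fm : fm [Nat; 2]%ty) (F :> @env_nil M).
    exists (const (zero_M M)); rewrite app_const; split=> //; apply/F1 => i.
    by rewrite app_const numK0 ltNge numK_ge0.
  move=> [d [/F1 hd e]]; have [f hf] := exists_B k.
  exists (snoc d f k); rewrite snoc0; split=> //; apply/F1 => i.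
  rewrite snoc0 numKD numK1 => hi; have : i%:K <= k%:K.
    by rewrite leNgt; apply/negP => /num_succ_le; move: hi; lra.
  rewrite le_eqVlt => /orP [/eqP /numK_inj ->|ik].
    by rewrite slice_snoc_last tail_cons.
  by rewrite slice_snoc //; apply: hd; rewrite e.
move: (sub0); rewrite /SUB0; cbn [sat] => /(_ F L X x) S.
have [|||||||Phi [P1 [_ P3]]] := S.
- move=> d; exact: (le_1_cases (F01 d)).
- move=> d e; apply: (@le_1_cases (app (app L d) e)); rewrite LE.
  by have [[_ ->]|[_ ->]] := is_zero_cases (monus_M (app d (zero_M M)) (app e (zero_M M)));
    auto.
- split; [|split; [|split]].
  + by have [d [Dd _]] := long (zero_M M); exists d.
  + move=> d _ e _ w _ de ew; apply/L1; move/L1: de => de; move/L1: ew; exact: le_trans.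
  + by move=> d _; apply/L1.
  + move=> d Dd e De; have [h|h] := leP (len d) (len e).
      by exists e; split; [exact: De|split; apply/L1].
    by exists d; split; [exact: Dd|split; apply/L1 => //; apply: ltW].
- move=> d _; split; [|split].
  + by apply/sat_is_real; apply: real_X.
  + apply/sat_le_R => n; rewrite at_zero -[ev _ _]/(app X d) XE.
    have := eps_gt0 n; have : 0 <= len d / (len d + 1); last by lra.
    by rewrite divr_ge0 // addr_ge0.
  + apply/sat_le_R => n; rewrite at_one -[ev _ _]/(app X d) XE.
    have := eps_gt0 n; have : len d / (len d + 1) <= 1; last by lra.
    by rewrite ler_pdivrMr ?ltr_wpDl // mul1r lerDl.
- move=> d _ e _ /L1 de; apply/sat_le_R.
  change (le_r (app X d) (app X e)) => n; rewrite !XE.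
  have := eps_gt0 n; have : len d / (len d + 1) <= len e / (len e + 1); last by lra.
  by apply: fraction_le.
- split; [|split]; first by apply/sat_is_real.
  + by apply/sat_le_R => n; rewrite at_zero xE; have := eps_gt0 n; lra.
  + by apply/sat_le_R => n; rewrite !at_one; have := eps_gt0 n; lra.
- move=> e /sat_is_real re /pos_realE he.
  have [c [m0 [c0 hc]]] := pos_realP re (at_zero enil) he.
  have [k hk] := frac_num c0; have [d0 [D0 e0]] := long k.
  exists d0; split; first exact: D0.
  move=> d _ /L1; rewrite e0 => kd; apply/sat_lt_R; rewrite eval_dist_R.
  apply: (dist_lt (d := (len d + 1)^-1) hc _ (n0 := m0)).
    exact: inv_succ_lt c0 hk kd.
  by move=> n _; rewrite dist; have := eps_gt0 n; lra.
rewrite /seq_converges /AllPosReal in P3; cbn [sat] in P3.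
have {}P3 k : exists n, k%:K < len (app Phi n).
  (* The distance to the limit is [1 / (len + 1)], so tolerance [1 / (k + 1)] forces a length above
     [k]. *)
  pose c := rat_M (one_M M) (zero_M M) k.
  have qc : qval c = (k%:K + 1)^-1 by rewrite qval_rat numK0 numK1 subr0 div1r.
  have c0 : 0 < qval c by rewrite qc invr_gt0 ltr_wpDl ?numK_ge0.
  have [||n h] := P3 (const c).
  - by apply/sat_is_real; apply: real_const.
  - by apply/pos_realE; apply: pos_const.
  have {h}/sat_lt_R := h n (or_intror Logic.eq_refl).
  rewrite eval_dist_R; set a := ev _ (_ $ _)%tm.
  have -> : a = app X (app Phi n) by rewrite /a; cbn [eval]; rewrite !eval_wk eval_lam.
  move=> [m]; rewrite at_dist dist -[ev _ _]/(const c) at_const qc => h.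
  exists n; rewrite -(ltrD2r 1) -ltf_pV2 ?posrE ?ltr_wpDl ?numK_ge0 //.
  by have := eps_gt0 m; lra.
(* [QFAC 1 0] takes functions as arguments, so a number [k] enters as the constant function and is
   read off at 0. *)
have [g hg] : exists g : dom M (1 ~> 0), forall d : R,
    st ((v1 $ 0 < v2 $ v0 $ 0)%fm : fm [Nat; 1; 0 ~> 1]%ty) (app g d :> (d :> (Phi :> enil))).
  apply: (choice_sat qfac10) => // d.
  by have [n hn] := P3 (app d (zero_M M)); exists n; apply/lessE.
(* [Y k] is entry [k] of the sequence at place [g (const k)], which is long enough to contain it. *)
pose Y : dom M (0 ~> 1) := ev (g :> (Phi :> enil))
  (lam (lam (v3 $ (v2 $ lam v2) $ (pairN v1 v0 + 1))))%tm.
exists Y => k; pose n := app g (const k).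
have hk : k%:K < len (app Phi n).
  by have /lessE := hg (const k); cbn [eval]; rewrite -[X in X%:K < _]/(app (const k) (zero_M M))
    app_const.
have /F1/(_ k hk) : app F (app Phi n) = one_M M := P1 n.
suff -> : tail (slice (app Phi n) k) = app Y k by [].
apply/esym/tail_unique => m; rewrite sliceS !eval_lam; cbn [eval].
by rewrite eval_pairN.
Qed.
End Instance.
End Choice.

Theorem SUB0_QFAC01 : st SUB0 env_nil -> forall A, QFAC 0 1 A -> st A env_nil.
Proof.
move=> sub0 _ [G A qA]; apply/sat_closure => rho; rewrite /choice; cbn [sat] => h.
have [Y hY] := choice_01_instance sub0 qA h; exists Y => n.
rewrite sat_subst; have := hY n; congr (st A _).
by apply: fam_ext => // r v; move: r v; apply: mem_case.
Qed.
End Numbers.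

(** [QF-AC^{0,1}] is a schema and [SUB0] a single sentence, so the equivalence takes the form of two
    derivability claims, one of them for each instance of the schema. *)
Theorem corollary4p6 :
  (forall A, QFAC 0 1 A -> proves (RCA0omega + IND + axiom ADS + axiom SUB0) A)
  /\ proves (RCA0omega + IND + axiom ADS + QFAC 0 1) SUB0.
Proof.
split.
- intros A hA; apply completeness; [intros B h; left; left; now left|].
  intros M ext ax.
  apply (@SUB0_QFAC01 (Build_model ext (fun B h => ax B (or_introl (or_introl (or_introl h))))
    (fun B h => ax B (or_introl (or_introl (or_intror h)))))); [|exact hA].
  apply ax; now right.
- apply completeness; [intros B h; left; left; now left|].
  intros M ext ax.
  apply (@QFAC01_SUB0 (Build_model ext (fun B h => ax B (or_introl (or_introl (or_introl h))))
    (fun B h => ax B (or_introl (or_introl (or_intror h)))))).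
  intros B h; apply ax; now right.
Qed.
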